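(* For every topological space $X$ there is an isomorphism of topological groups $$h_X:F_M(\pi_0^{qtop}(X))\to \pi_1^{\tau}(\Sigma(X_+)),$$ natural in $X$, which sends the generator corresponding to the path component of a point $x\in X$ to the homotopy class of the loop $u_x(t)=x\wedge t$.
   Context: All spaces of maps carry the compact-open topology. For a based space $(Y,y_0)$, $\Omega(Y,y_0)$ is the space of loops $I=[0,1]\to Y$ based at $y_0$. The quasitopological fundamental group $\pi_1^{qtop}(Y,y_0)$ is the fundamental group $\pi_1(Y,y_0)$ with the quotient topology with respect to the map $\pi:\Omega(Y,y_0)\to\pi_1(Y,y_0)$, $\alpha\mapsto[\alpha]$. For a space $Y$, the free (Markov) topological group $F_M(Y)$ is the free group on the underlying set of $Y$ with the unique group topology such that the inclusion of generators $\sigma:Y\to F_M(Y)$ is continuous and every continuous map $Y\to H$ to a topological group extends uniquely to a continuous homomorphism $F_M(Y)\to H$. A group with topology is a group with an arbitrary topology. For such a $G$, $\tau(G)$ is the group $G$ with the quotient topology with respect to the multiplication epimorphism $m_G:F_M(G)\to G$, i.e. the homomorphism sending each generator $g$ to $g$. Define $\pi_1^{\tau}(Y,y_0)=\tau(\pi_1^{qtop}(Y,y_0))$; this is a topological group. The path component space $\pi_0^{qtop}(X)$ is the set of path components of $X$ with the quotient topology from $X$. The generalized wedge of circles on a space $X$ is $\Sigma(X_+)=X\times I/(X\times\{0,1\})$, based at the image of $X\times\{0,1\}$; the image of $(x,t)$ is written $x\wedge t$. *)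

(* Defs.v *)
From HB Require Import structures.
From mathcomp Require Import all_boot all_order all_algebra.
From mathcomp Require Import all_classical all_reals topology.
From mathcomp Require Import Rstruct Rstruct_topology.
From Stdlib Require Import Relations.Relation_Operators.

Unset Implicit Arguments.
Unset Strict Implicit.
Unset Printing Implicit Defensive.

Import Order.TTheory GRing.Theory Num.Theory.
Local Open Scope classical_set_scope.
Local Open Scope ring_scope.

Definition choose {T : Type} (x0 : T) (P : T -> Prop) : T :=
  match pselect (exists x, P x) with
  | left h => proj1_sig (cid h)
  | right _ => x0
  end.

(* the set of equivalence classes of [r] (r is an equivalence in all uses) *)
Definition Quot {T : Type} (r : T -> T -> Prop) : Type :=
  {A : set T | exists x, A = r x}.

Definition qcls {T : Type} (r : T -> T -> Prop) (x : T) : Quot r :=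
  exist _ (r x) (ex_intro _ x erefl).

Definition qrep {T : Type} {r : T -> T -> Prop} (A : Quot r) : T :=
  proj1_sig (cid (proj2_sig A)).

Definition is_topology {T : Type} (O : set (set T)) : Prop :=
  [/\ O setT,
      (forall U V, O U -> O V -> O (U `&` V)) &
      (forall F : set (set T), F `<=` O -> O (\bigcup_(U in F) U))].

Definition gen_top {T : Type} (B : set (set T)) : set (set T) :=
  fun U => forall O, is_topology O -> B `<=` O -> O U.

Definition rcont {A B : Type} (OA : set (set A)) (OB : set (set B)) (f : A -> B) : Prop :=
  forall V, OB V -> OA (f @^-1` V).

Definition prod_top {A B : Type} (OA : set (set A)) (OB : set (set B)) : set (set (A * B)) :=
  gen_top [set W | exists U V, [/\ OA U, OB V & W = U `*` V]].

Definition sub_top {A : Type} (P : A -> Prop) (OA : set (set A)) : set (set {x : A | P x}) :=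
  [set W | exists U, OA U /\ W = (@proj1_sig A P) @^-1` U].
Arguments sub_top {A} P OA.

Definition quot_top {A B : Type} (OA : set (set A)) (q : A -> B) : set (set B) :=
  [set V | OA (q @^-1` V)].

Definition rcompact {A : Type} (OA : set (set A)) (K : set A) : Prop :=
  forall F : set (set A), F `<=` OA -> K `<=` \bigcup_(U in F) U ->
    exists G : set (set A), [/\ finite_set G, G `<=` F & K `<=` \bigcup_(U in G) U].

Notation RR := Rdefinitions.R.
Definition I := {t : RR | (0 <= t <= 1)%R}.
Lemma I0_proof : (0 <= (0 : RR) <= 1)%R. Proof. by rewrite lexx ler01. Qed.
Lemma I1_proof : (0 <= (1 : RR) <= 1)%R. Proof. by rewrite lexx ler01. Qed.
Definition i0 : I := exist _ 0 I0_proof.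
Definition i1 : I := exist _ 1 I1_proof.
Definition I_top : set (set I) := @sub_top RR (fun t : RR => is_true (0 <= t <= 1)%R) (@open RR).

Definition path_conn {T : Type} (O : set (set T)) (x y : T) : Prop :=
  exists p : I -> T, [/\ rcont I_top O p, p i0 = x & p i1 = y].

Definition pi0 {T : Type} (O : set (set T)) : Type := Quot (path_conn O).
Definition pi0_cls {T : Type} (O : set (set T)) (x : T) : pi0 O := qcls (path_conn O) x.
Definition pi0_top {T : Type} (O : set (set T)) : set (set (pi0 O)) := quot_top O (pi0_cls O).
Definition pi0_map {T T' : Type} (O : set (set T)) (O' : set (set T')) (f : T -> T')
  (A : pi0 O) : pi0 O' := pi0_cls O' (f (qrep A)).

Definition is_loop {Y : Type} (OY : set (set Y)) (y0 : Y) (f : I -> Y) : Prop :=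
  [/\ rcont I_top OY f, f i0 = y0 & f i1 = y0].

Definition loop {Y : Type} (OY : set (set Y)) (y0 : Y) : Type := {f : I -> Y | is_loop OY y0 f}.

Definition compact_open {Y : Type} (OY : set (set Y)) : set (set (I -> Y)) :=
  gen_top [set W | exists K U, [/\ rcompact I_top K, OY U & W = [set f | f @` K `<=` U]]].

Definition loop_top {Y : Type} (OY : set (set Y)) (y0 : Y) : set (set (loop OY y0)) :=
  sub_top (is_loop OY y0) (compact_open OY).

Definition loop_homotopic {Y : Type} (OY : set (set Y)) (y0 : Y) (a b : loop OY y0) : Prop :=
  exists H : I * I -> Y,
    [/\ rcont (prod_top I_top I_top) OY H,
        forall s, H (s, i0) = proj1_sig a s,
        forall s, H (s, i1) = proj1_sig b s,
        forall t, H (i0, t) = y0 &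
        forall t, H (i1, t) = y0].

Lemma cst_loop_proof {Y : Type} (OY : set (set Y)) (y0 : Y) : is_loop OY y0 (fun _ => y0).
Proof.
split=> // V _.
have [Vy|nVy] := pselect (V y0).
  exists setT; split; first exact: openT.
  by rewrite !preimage_setT; apply/seteqP; split=> x //=.
exists set0; split; first exact: open0.
by rewrite preimage_set0; apply/seteqP; split=> x //=.
Qed.
Definition cst_loop {Y : Type} (OY : set (set Y)) (y0 : Y) : loop OY y0 :=
  exist _ (fun _ => y0) (cst_loop_proof OY y0).

Definition pi1 {Y : Type} (OY : set (set Y)) (y0 : Y) : Type := Quot (loop_homotopic OY y0).
Definition pi1_cls {Y : Type} {OY : set (set Y)} {y0 : Y} (a : loop OY y0) : pi1 OY y0 :=
  qcls (loop_homotopic OY y0) a.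

Definition is_concat {Y : Type} (a b c : I -> Y) : Prop :=
  forall t s : I,
    (proj1_sig t <= 1/2 -> proj1_sig s = 2 * proj1_sig t -> c t = a s) /\
    (1/2 <= proj1_sig t -> proj1_sig s = 2 * proj1_sig t - 1 -> c t = b s).
Definition is_reverse {Y : Type} (a c : I -> Y) : Prop :=
  forall t s : I, proj1_sig s = 1 - proj1_sig t -> c t = a s.

Definition pi1_one {Y : Type} (OY : set (set Y)) (y0 : Y) : pi1 OY y0 :=
  pi1_cls (cst_loop OY y0).
Definition pi1_mul {Y : Type} (OY : set (set Y)) (y0 : Y) (A B : pi1 OY y0) : pi1 OY y0 :=
  choose A (fun C => exists a b c, [/\ A = pi1_cls a, B = pi1_cls b, C = pi1_cls c &
                                      is_concat (proj1_sig a) (proj1_sig b) (proj1_sig c)]).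
Definition pi1_inv {Y : Type} (OY : set (set Y)) (y0 : Y) (A : pi1 OY y0) : pi1 OY y0 :=
  choose A (fun C => exists a c, [/\ A = pi1_cls a, C = pi1_cls c &
                                    is_reverse (proj1_sig a) (proj1_sig c)]).
Definition pi1_qtop {Y : Type} (OY : set (set Y)) (y0 : Y) : set (set (pi1 OY y0)) :=
  quot_top (loop_top OY y0) (@pi1_cls Y OY y0).

Definition pi1_map {Y Y' : Type} (OY : set (set Y)) (y0 : Y) (OY' : set (set Y')) (y0' : Y')
  (g : Y -> Y') (A : pi1 OY y0) : pi1 OY' y0' :=
  choose (pi1_one OY' y0') (fun C => exists a c, [/\ A = pi1_cls a, C = pi1_cls c &
                                        forall t, proj1_sig c t = g (proj1_sig a t)]).

Definition word (S : Type) := seq (S * bool).  (* (s,true) = s, (s,false) = s^-1 *)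
Definition red1 {S : Type} (u v : word S) : Prop :=
  exists w1 w2 s b, u = w1 ++ (s, b) :: (s, ~~ b) :: w2 /\ v = w1 ++ w2.
Definition word_eqv {S : Type} : word S -> word S -> Prop := clos_refl_sym_trans (word S) red1.

Definition FG (S : Type) : Type := Quot (@word_eqv S).
Definition FG_cls {S : Type} (w : word S) : FG S := qcls word_eqv w.
Definition FG_mul {S : Type} (A B : FG S) : FG S := FG_cls (qrep A ++ qrep B).
Definition FG_inv {S : Type} (A : FG S) : FG S :=
  FG_cls (rev (map (fun p : S * bool => (p.1, ~~ p.2)) (qrep A))).
Definition FG_one {S : Type} : FG S := FG_cls [::].
Definition FG_gen {S : Type} (s : S) : FG S := FG_cls [:: (s, true)].
Definition FG_map {S S' : Type} (phi : S -> S') (A : FG S) : FG S' :=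
  FG_cls (map (fun p : S * bool => (phi p.1, p.2)) (qrep A)).

Definition group_topology {G : Type} (mul : G -> G -> G) (inv : G -> G) (O : set (set G)) : Prop :=
  [/\ is_topology O, rcont (prod_top O O) O (fun p => mul p.1 p.2) & rcont O O inv].

(* F_M(S): the free group on S with the finest group topology making the
   inclusion of generators continuous (the free Markov topological group). *)
Definition FM_top {S : Type} (OS : set (set S)) : set (set (FG S)) :=
  gen_top [set V | exists O, [/\ group_topology FG_mul FG_inv O, rcont OS O FG_gen & O V]].

Definition mult_epi {G : Type} (mul : G -> G -> G) (inv : G -> G) (one : G) (A : FG G) : G :=
  foldr (fun p acc => mul (if p.2 then p.1 else inv p.1) acc) one (qrep A).
Definition tau_top {G : Type} (mul : G -> G -> G) (inv : G -> G) (one : G) (OG : set (set G))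
  : set (set G) :=
  quot_top (FM_top OG) (mult_epi mul inv one).

Definition topgroup_iso {G H : Type} (mulG : G -> G -> G) (OG : set (set G))
  (mulH : H -> H -> H) (OH : set (set H)) (h : G -> H) : Prop :=
  [/\ bijective h, (forall a b, h (mulG a b) = mulH (h a) (h b)),
      rcont OG OH h & (forall U, OG U -> OH (h @` U))].

(* X_+ = option X, with None the added isolated base point *)
Definition plus_top (X : topologicalType) : set (set (option X)) :=
  [set U | open (Some @^-1` U)].
Definition susp_base {X : Type} (p : option X * I) : Prop :=
  p.1 = None \/ p.2 = i0 \/ p.2 = i1.
Definition susp_rel {X : Type} (p q : option X * I) : Prop :=
  p = q \/ (susp_base p /\ susp_base q).
Definition susp (X : Type) : Type := Quot (@susp_rel X).
Definition susp_q {X : Type} (p : option X * I) : susp X := qcls susp_rel p.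
Definition susp_top (X : topologicalType) : set (set (susp X)) :=
  quot_top (prod_top (plus_top X) I_top) susp_q.
Definition susp_pt {X : Type} : susp X := susp_q (None, i0).
Definition wedge_pt {X : Type} (x : X) (t : I) : susp X := susp_q (Some x, t).
Definition susp_map {X Y : Type} (f : X -> Y) (A : susp X) : susp Y :=
  susp_q (omap f (qrep A).1, (qrep A).2).

Definition piS (X : topologicalType) : Type := pi1 (susp_top X) susp_pt.
Definition piS_mul (X : topologicalType) : piS X -> piS X -> piS X :=
  @pi1_mul _ (susp_top X) susp_pt.
Definition piS_tau (X : topologicalType) : set (set (piS X)) :=
  tau_top (piS_mul X) (@pi1_inv _ (susp_top X) susp_pt) (pi1_one (susp_top X) susp_pt)
          (pi1_qtop (susp_top X) susp_pt).
Definition piS_map (X Y : topologicalType) (f : X -> Y) : piS X -> piS Y :=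
  pi1_map (susp_top X) susp_pt (susp_top Y) susp_pt (susp_map f).

Definition FMpi0 (X : topologicalType) : Type := FG (pi0 (@open X)).
Definition FMpi0_top (X : topologicalType) : set (set (FMpi0 X)) := FM_top (pi0_top (@open X)).

(* Main.v *)
Require Import Defs.
From HB Require Import structures.
From mathcomp Require Import all_boot all_order all_algebra finmap.
From mathcomp Require Import all_classical all_reals topology.
From mathcomp Require Import Rstruct Rstruct_topology.
From mathcomp Require Import normedtype ring lra.
From Stdlib Require Import Relations.Relation_Operators.
Import Order.TTheory GRing.Theory Num.Theory.
Import numFieldNormedType.Exports.
Local Open Scope classical_set_scope.
Local Open Scope ring_scope.

(* Cover the suspension by [UA], the points [x /\ t] with [0 < t < 1], and [UB], the complement of
   the closed middle third [1/3 <= t <= 2/3]; the latter contracts to the base point.  The free group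
   on the path components of X, glued along [UA :&: UB] by the function [trans] equal to [[x]] for
   [t > 1/2] and to [1] for [t < 1/2], is a principal bundle with discrete fibre, and the inverse of
   [h] is its monodromy: lift a loop starting from [1] and read off the end point.  One lemma on lifts
   depending on a parameter ([lift_cont_at]) gives both the homotopy invariance of the monodromy (for
   the discrete topology) and its continuity on the loop space (for the Markov topology).  That [h]
   undoes the monodromy follows from the uniqueness of lifts, now with values in the fundamental
   group: the class of [f] restricted to [[0, s]] and closed up along a ray is such a lift in [s].
   The two continuity statements then follow from the universal properties of the free topological
   group and of [tau]. *)

(** * Quotients and topologies given by their open sets *)

(** Nothing is assumed about [X] locally, so path components need not be open and the glued bundle
    need not be a covering space: its transition function need not be locally constant on the
    overlap of the two charts. The bundle is therefore only ever looked at along paths. A path in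
    the overlap has an [X]-coordinate that stays in one path component, and its height cannot cross
    1/2, where [trans] jumps, because 1/2 lies in the third removed from [UB]. So [trans] is
    constant along it, and this alone carries existence and uniqueness of lifts. When the loop
    itself varies, the component may change; only the continuity of the generators then remains.
    This is why the lemma on parameters is stated for an arbitrary group topology, while lifting is
    purely algebraic. Multiplication need not be continuous in the quotient topology of the
    fundamental group. Hence nothing is deduced from it there: the inverse is tested on the loop
    space, and the group structure enters again only after passing to [tau]. *)

Lemma qcls_eq {T : Type} {r : T -> T -> Prop} (rs : forall x y, r x y -> r y x)
    (rt : forall x y z, r x y -> r y z -> r x z) x y : r x y -> qcls r x = qcls r y.
Proof.
move=> rxy; apply: eq_exist; apply/seteqP; split=> z /=; last exact: rt.
exact/rt/rs.
Qed.

Lemma qcls_inj {T : Type} {r : T -> T -> Prop} (rr : forall x, r x x) x y :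
  qcls r x = qcls r y -> r x y.
Proof. by move=> [e]; rewrite e; apply: rr. Qed.

Lemma qrepK {T : Type} {r : T -> T -> Prop} (A : Quot r) : qcls r (qrep A) = A.
Proof.
rewrite /qrep; case: cid => x /= e.
by case: A e => A h /= e; apply: eq_exist.
Qed.

Lemma top_setI {A : Type} {OA : set (set A)} U V :
  is_topology OA -> OA U -> OA V -> OA (U `&` V).
Proof. by case=> _ + _; apply. Qed.

Lemma top_local {A : Type} {OA : set (set A)} (hO : is_topology OA) (W : set A) :
  (forall x, W x -> exists U, [/\ OA U, U x & U `<=` W]) -> OA W.
Proof.
move=> h; suff -> : W = \bigcup_(U in [set U | OA U /\ U `<=` W]) U.
  by case: hO => _ _; apply=> U [].
apply/seteqP; split=> x; last by case=> U [_ UW] /UW.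
by move=> /h[U [OU Ux UW]]; exists U.
Qed.

Lemma top_setU {A : Type} {OA : set (set A)} U V :
  is_topology OA -> OA U -> OA V -> OA (U `|` V).
Proof.
move=> hO OU OV; apply: top_local => // x [xU|xV].
  by exists U; split=> //; apply: subsetUl.
by exists V; split=> //; apply: subsetUr.
Qed.

Lemma gen_top_is_topology {A : Type} (G : set (set A)) : is_topology (gen_top G).
Proof.
split; first by move=> O [].
- by move=> U V hU hV O hO GO; apply: top_setI (hU _ hO GO) (hV _ hO GO).
- by move=> F hF O hO GO; case: (hO) => _ _; apply=> U FU; apply: hF.
Qed.

Lemma gen_top_sub {A : Type} (G : set (set A)) : G `<=` gen_top G.
Proof. by move=> U GU O _; apply. Qed.

Lemma quot_top_is_topology {A B : Type} {OA : set (set A)} (q : A -> B) :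
  is_topology OA -> is_topology (quot_top OA q).
Proof.
move=> [O1 O2 O3]; split=> //=.
- by move=> U U' hU hU'; rewrite /quot_top/= preimage_setI; apply: O2.
- move=> F hF; rewrite /quot_top/= preimage_bigcup.
  rewrite [X in OA X](_ : _ = \bigcup_(U in [set q @^-1` U | U in F]) U).
    by apply: O3 => _ [U FU <-]; apply: hF.
  apply/seteqP; split=> x [U FU] Ux; first by exists (q @^-1` U) => //; exists U.
  by case: FU Ux => {}U FU <-; exists U.
Qed.

Lemma rcont_gen {A B : Type} {OA : set (set A)} (G : set (set B)) (f : A -> B) :
  is_topology OA -> (forall V, G V -> OA (f @^-1` V)) -> rcont OA (gen_top G) f.
Proof. by move=> hO h V hV; apply: (hV (quot_top OA f)) => //; exact: quot_top_is_topology. Qed.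

Lemma sub_top_is_topology {A : Type} {P : A -> Prop} {OA : set (set A)} :
  is_topology OA -> is_topology (sub_top P OA).
Proof.
move=> hA; have [O1 O2 O3] := hA; split.
- by exists setT; rewrite preimage_setT.
- by move=> _ _ [U [OU ->]] [V [OV ->]]; exists (U `&` V); split=> //; apply: O2.
- move=> F hF.
  exists (\bigcup_(U in [set U | OA U /\ F (@proj1_sig A P @^-1` U)]) U); split.
    by apply: O3 => U [].
  apply/seteqP; split=> x [U FU Ux].
    have [V [OV e]] := hF _ FU; exists V; first by split=> //; rewrite -e.
    by move: Ux; rewrite e.
  by exists (@proj1_sig A P @^-1` U) => //; case: FU.
Qed.

Lemma open_is_topology (T : topologicalType) : is_topology (@open T).
Proof.
split; [exact: openT|exact: openI|].
by move=> F hF; apply: bigcup_open => U /hF.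
Qed.

Lemma rcont_id {A : Type} {OA : set (set A)} : rcont OA OA id.
Proof. by []. Qed.

Lemma rcont_comp {A B C : Type} {OA : set (set A)} {OB : set (set B)} {OC : set (set C)}
  (g : B -> C) (f : A -> B) :
  rcont OB OC g -> rcont OA OB f -> rcont OA OC (fun x => g (f x)).
Proof. by move=> hg hf V /hg /hf. Qed.

Lemma rcont_cst {A B : Type} {OA : set (set A)} {OB : set (set B)} (b : B) :
  is_topology OA -> rcont OA OB (fun=> b).
Proof.
move=> hA V _; apply: top_local => // x Vb.
by exists setT; split=> //; case: hA.
Qed.

Lemma rcont_continuous {S T : topologicalType} (f : S -> T) :
  continuous f -> rcont open open f.
Proof. by move/continuousP. Qed.

Section products.
Context {A B C : Type} {OA : set (set A)} {OB : set (set B)} {OC : set (set C)}.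
Hypotheses (hA : is_topology OA) (hB : is_topology OB).

Lemma prod_top_is_topology : is_topology (prod_top OA OB).
Proof. exact: gen_top_is_topology. Qed.

Lemma prod_topX U V : OA U -> OB V -> prod_top OA OB (U `*` V).
Proof. by move=> OU OV O hO; apply; exists U, V. Qed.

Lemma prod_topP W :
  prod_top OA OB W <->
  forall p, W p -> exists U V, [/\ OA U, OB V, U p.1, V p.2 & U `*` V `<=` W].
Proof.
split=> [hW|h]; last first.
  apply: top_local => [|p /h[U [V [OU OV Up Vp s]]]].
    exact: prod_top_is_topology.
  by exists (U `*` V); split=> //; apply: prod_topX.
apply: (hW [set W | forall p, W p ->
  exists U V, [/\ OA U, OB V, U p.1, V p.2 & U `*` V `<=` W]]); last first.
  by move=> _ [U [V [OU OV ->]]] p [? ?]; exists U, V; split.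
split.
- by move=> p _; exists setT, setT; case: hA hB => ? _ _ [].
- move=> W1 W2 h1 h2 p [/h1[U1 [V1 [? ? ? ? s1]]] /h2[U2 [V2 [? ? ? ? s2]]]].
  exists (U1 `&` U2), (V1 `&` V2); split=> //; [exact: top_setI|exact: top_setI|].
  by move=> q [[? ?] [? ?]]; split; [apply: s1|apply: s2].
- move=> F hF p [W' FW' /(hF _ FW')[U [V [? ? ? ? s]]]].
  by exists U, V; split=> // q /s; exists W'.
Qed.

Lemma rcont_fst : rcont (prod_top OA OB) OA fst.
Proof.
move=> V OV; rewrite (_ : _ @^-1` _ = V `*` setT).
  by apply: prod_topX => //; case: hB.
by apply/seteqP; split=> [p Vp|p []].
Qed.

Lemma rcont_snd : rcont (prod_top OA OB) OB snd.
Proof.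
move=> V OV; rewrite (_ : _ @^-1` _ = setT `*` V).
  by apply: prod_topX => //; case: hA.
by apply/seteqP; split=> [p Vp|p []].
Qed.

Lemma rcont_pair (f : C -> A) (g : C -> B) : is_topology OC ->
  rcont OC OA f -> rcont OC OB g -> rcont OC (prod_top OA OB) (fun x => (f x, g x)).
Proof.
move=> hC hf hg; apply: rcont_gen => // _ [U [V [OU OV ->]]].
exact: top_setI hC (hf _ OU) (hg _ OV).
Qed.
End products.

Lemma open_prod (S T : topologicalType) :
  prod_top (@open S) (@open T) = @open (S * T)%type.
Proof.
apply/seteqP; split=> W.
  move=> hW; apply: (hW _ (open_is_topology _)) => _ [U [V [OU OV ->]]].
  have -> : U `*` V = fst @^-1` U `&` snd @^-1` V by [].
  by apply: openI; apply: open_comp => // x _; [exact: cvg_fst|exact: cvg_snd].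
move=> OW; apply/(prod_topP (open_is_topology _) (open_is_topology _)).
move=> p Wp; have /= := open_nbhs_nbhs (conj OW Wp).
case=> -[U V] /= [].
rewrite !nbhsE => -[U' [OU' U'p] UU'] [V' [OV' V'p] VV'] s.
exists U', V'; split=> // q [/UU' q1 /VV' q2]; exact: s.
Qed.

(** * The real line and the unit interval *)

Lemma openRP (U : set RR) :
  open U <-> forall t, U t -> exists2 e : RR, 0 < e & forall s, t - e < s < t + e -> U s.
Proof.
rewrite openE; split=> h t /h.
  rewrite /interior /= => /nbhs_ballP[e /= e0 s]; exists e => // r hr; apply: s.
  by rewrite /ball /= distrC ltr_distl.
case=> e e0 s; apply/nbhs_ballP; exists e => // r /=.
by rewrite /ball /= distrC ltr_distl => /s.
Qed.

Lemma small_pos (a b : RR) : 0 < a -> 0 < b -> exists2 d : RR, 0 < d & d <= a /\ d <= b.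
Proof. by exists (Num.min a b); case: (leP a b) => ?; rewrite ?lexx //; split; lra. Qed.

Lemma open_itv_oo (a b : RR) : open [set r : RR | a < r < b].
Proof.
apply/openRP => t /= /andP[at_ tb]; exists (Num.min (t - a) (b - t)).
  by rewrite lt_min !subr_gt0 at_.
by move=> s; case: (leP (t - a) (b - t)) => h /andP[? ?]; lra.
Qed.

Lemma open_gtR (a : RR) : open [set r : RR | a < r].
Proof.
apply/openRP => t /= h; exists (t - a); first lra.
by move=> s /andP[? ?]; lra.
Qed.

Lemma open_ltR (a : RR) : open [set r : RR | r < a].
Proof.
apply/openRP => t /= h; exists (a - t); first lra.
by move=> s /andP[? ?]; lra.
Qed.

(** Connectedness of the line: the hypothesis makes both [P] and its complement open. It stands in
    for subdividing an interval by a Lebesgue number. *)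
Lemma local_induction (P : RR -> Prop) (t0 : RR) :
  (forall t, exists2 e : RR, 0 < e &
    forall r s, t - e < r < t + e -> t - e < s < t + e -> P r -> P s) ->
  P t0 -> forall t, P t.
Proof.
move=> h P0 t.
suff -> : P = setT by [].
have cT : connected [set: RR].
  by apply/connected_intervalP => x y _ _ z.
apply: cT; first by exists t0.
  exists P; last by rewrite setTI.
  apply/openRP => s Ps; have [e e0 he] := h s.
  by exists e => // r hr; apply: (he s) => //; apply/andP; split; lra.
exists P; last by rewrite setTI.
rewrite -openC; apply/openRP => s Ps; have [e e0 he] := h s.
exists e => // r hr Pr; apply: Ps; apply: (he r) => //; apply/andP; split; lra.
Qed.

Lemma locally_constant {T : Type} (g : RR -> T) :
  (forall t, exists2 e : RR, 0 < e & forall s, t - e < s < t + e -> g s = g t) ->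
  forall s t, g s = g t.
Proof.
move=> h s t; apply: (@local_induction (fun s => g s = g t) t) => // r.
have [e e0 he] := h r; exists e => // x y hx hy.
by rewrite (he _ hx) (he _ hy).
Qed.

Lemma rcompact_segment (a b : RR) : rcompact (@open RR) `[a, b].
Proof.
move=> F hF hK; have := @segment_compact RR a b; rewrite compact_cover.
move=> /(_ (set RR) F id (fun i Fi => hF i Fi) hK)[D DF hD].
exists [set` D]; split=> //; first exact: finite_fset.
by move=> U /DF; rewrite inE.
Qed.

Lemma rcompact_image {A B : Type} {OA : set (set A)} {OB : set (set B)} (f : A -> B) (K : set A) :
  rcont OA OB f -> rcompact OA K -> rcompact OB (f @` K).
Proof.
move=> hf hK F hF hKF.
have [||G [fG GF GK]] := hK [set f @^-1` U | U in F].
- by move=> _ [U FU <-]; apply: hf; apply: hF.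
- move=> x Kx; have [U FU Ux] := hKF (f x) (ex_intro2 _ _ x Kx erefl).
  by exists (f @^-1` U) => //; exists U.
(* Several members of [F] may have the same preimage; one is chosen for each member of the finite
   subcover. *)
pose pick V := Defs.choose set0 (fun U => F U /\ V = f @^-1` U).
have pickP V : G V -> F (pick V) /\ V = f @^-1` (pick V).
  move=> /GF[U FU e]; rewrite /pick /Defs.choose; case: pselect => [h|[]].
    by case: cid.
  by exists U.
exists (pick @` G); split; first exact: finite_image.
  by move=> _ [V /pickP[FV _] <-].
move=> _ [x /GK[V GV Vx] <-]; exists (pick V); first by exists V.
by have [_ e] := pickP _ GV; rewrite e in Vx.
Qed.

(** Finitely many boxes inside [W] cover the slice of [z] over [K]; the intersection of their first
    sides is the neighbourhood sought. *)
Lemma tube {A B : Type} {OA : set (set A)} {OB : set (set B)} (K : set B) (W : set (A * B)) :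
  is_topology OA -> is_topology OB -> rcompact OB K -> prod_top OA OB W ->
  OA [set z | forall b, K b -> W (z, b)].
Proof.
move=> hA hB hK /(prod_topP hA hB) hW; apply: top_local => // z hz.
pose F := [set V | OB V /\ exists U, [/\ OA U, U z & U `*` V `<=` W]].
have [||G [fG GF GK]] := hK F.
- by move=> V [].
- move=> b /hz /hW[U [V [OU OV Uz Vb s]]]; exists V => //; split=> //.
  by exists U.
have [U [OU Uz hU]] : exists U, [/\ OA U, U z & forall V, G V -> U `*` V `<=` W].
  have /finite_seqP[s e] := fG; rewrite {G GK}e in fG GF *.
  elim: s GF {fG} => [_|V s IH GF].
    by exists setT; split=> //; case: hA.
  have [|U [OU Uz hU]] := IH.
    by move=> V' V's; apply: GF; rewrite /= inE V's orbT.
  have [|_ [U' [OU' U'z hU']]] := GF V; first by rewrite /= inE eqxx.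
  exists (U `&` U'); split=> //; first exact: top_setI.
  move=> V'; rewrite /= inE => /orP[/eqP->|V's] [x y] [[Ux U'x] Vy].
    by apply: hU'.
  by apply: hU V's (x, y) _.
exists U; split=> // x Ux b /GK[V GV Vb]; exact: hU GV (x, b) _.
Qed.

(** The product of a quotient map with the line is a quotient map, since the line is locally
    compact. Replacing [r] by a compact segment [K] around it, the set of [y] with [F (y, b)] in [V]
    for all [b] in [K] lives on [Q] itself, and its preimage in [T] is open by [tube]. It serves for
    homotopies defined on the suspension. *)
Lemma whitehead {T Q Y : Type} {OT : set (set T)} {OY : set (set Y)} (q : T -> Q)
    (F : Q * RR -> Y) :
  is_topology OT -> (forall x, exists t, q t = x) ->
  rcont (prod_top OT open) OY (fun p : T * RR => F (q p.1, p.2)) ->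
  rcont (prod_top (quot_top OT q) open) OY F.
Proof.
move=> hT qs hF V OV.
have hQ : is_topology (quot_top OT q) by exact: quot_top_is_topology.
have hR := open_is_topology RR.
apply/(prod_topP hQ hR) => -[x r] /= Fxr; have [t qt] := qs x.
have hW := hF _ OV.
have [U [J [OU OJ Ut Jr s]]] := (prod_topP hT hR _).1 hW (t, r) ltac:(by rewrite /= qt).
have [e e0 he] := (openRP J).1 OJ r Jr.
pose K : set RR := [set` `[r - e / 2, r + e / 2]].
have KJ b : K b -> J b by rewrite /K /= in_itv /= => /andP[? ?]; apply: he; lra.
exists [set y | forall b, K b -> V (F (y, b))], [set b | r - e / 2 < b < r + e / 2].
split=> /=.
- exact: (tube K _ hT hR (rcompact_segment _ _) hW).
- exact: open_itv_oo.
- by rewrite -qt => b /KJ Jb; apply: (s (t, b)).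
- by lra.
- move=> [y b] /= [hy /andP[b1 b2]]; apply: hy.
  by rewrite /K /= in_itv /=; lra.
Qed.

Section real_functions.
Context {A : Type} {OA : set (set A)}.
Hypothesis hA : is_topology OA.
Notation RC := (rcont OA (@open RR)).

Lemma rcont_pairR (f g : A -> RR) (k : RR * RR -> RR) :
  rcont (prod_top open open) open k -> RC f -> RC g -> RC (fun x => k (f x, g x)).
Proof.
move=> hk hf hg; apply: rcont_comp hk _; apply: rcont_pair => //; exact: open_is_topology.
Qed.

Lemma rcontD (f g : A -> RR) : RC f -> RC g -> RC (fun x => f x + g x).
Proof.
apply: (@rcont_pairR f g (fun p => p.1 + p.2)) => V /openRP OV.
apply/(prod_topP (open_is_topology _) (open_is_topology _)) => -[x y] /= /OV[e e0 he].
exists [set r | x - e / 2 < r < x + e / 2], [set r | y - e / 2 < r < y + e / 2].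
split=> /=; [exact: open_itv_oo|exact: open_itv_oo|lra|lra|].
by move=> [r s] /= [/andP[? ?] /andP[? ?]]; apply: he; lra.
Qed.

Lemma rcontM (f g : A -> RR) : RC f -> RC g -> RC (fun x => f x * g x).
Proof.
apply: (@rcont_pairR f g (fun p => p.1 * p.2)); rewrite open_prod; apply: rcont_continuous => p.
by apply: cvgM; [apply: cvg_fst|apply: cvg_snd].
Qed.

Lemma rcontN (f : A -> RR) : RC f -> RC (fun x => - f x).
Proof.
move=> hf; apply: (rcont_comp (fun r : RR => - r)) hf => V /openRP OV.
apply/openRP => r /= /OV[e e0 he]; exists e => // s /andP[? ?]; apply: he; lra.
Qed.

Lemma rcontB (f g : A -> RR) : RC f -> RC g -> RC (fun x => f x - g x).
Proof. by move=> hf hg; apply: rcontD => //; apply: rcontN. Qed.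

(** The two pieces are closed, while topologies are given by open sets; writing the preimage as an
    intersection of two unions avoids closed sets. *)
Lemma rcont_paste {Y : Type} {OY : set (set Y)} (k : A -> RR) (c : RR) (f1 f2 : A -> Y) :
  RC k -> rcont OA OY f1 -> rcont OA OY f2 -> (forall x, k x = c -> f1 x = f2 x) ->
  rcont OA OY (fun x => if k x <= c then f1 x else f2 x).
Proof.
move=> hk h1 h2 h12 V OV.
have Og := hk _ (open_gtR c); have Ol := hk _ (open_ltR c).
rewrite (_ : _ @^-1` _ = (f1 @^-1` V `|` k @^-1` [set r | c < r]) `&`
                         (f2 @^-1` V `|` k @^-1` [set r | r < c])).
  by apply: top_setI => //; apply: top_setU => //; [apply: h1|apply: h2].
apply/seteqP; split=> x /=.
  case: (ltgtP (k x) c) => h; [by move=> ?; split; [left|right]|by move=> ?; split; [right|left]|].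
  by rewrite -h12 // => ?; split; left.
case: (ltgtP (k x) c) => h [] [] // h1x [] //.
Qed.

Lemma rcont_min (f g : A -> RR) : RC f -> RC g -> RC (fun x => Num.min (f x) (g x)).
Proof.
move=> hf hg; rewrite (_ : (fun x => _) = (fun x => if f x - g x <= 0 then f x else g x)).
  by apply: rcont_paste => //; [exact: rcontB|move=> x; lra].
by apply/funext => x; rewrite subr_le0; case: leP.
Qed.

Lemma rcont_max (f g : A -> RR) : RC f -> RC g -> RC (fun x => Num.max (f x) (g x)).
Proof.
move=> hf hg; rewrite (_ : (fun x => _) = (fun x => if f x - g x <= 0 then g x else f x)).
  by apply: rcont_paste => //; [exact: rcontB|move=> x; lra].
by apply/funext => x; rewrite subr_le0; case: leP.
Qed.
End real_functions.

(** * The unit interval as a retract of the line *)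

Lemma I_top_is_topology : is_topology I_top.
Proof. exact: (sub_top_is_topology (open_is_topology _)). Qed.

Definition clampR (r : RR) : RR := Num.max 0 (Num.min 1 r).

Lemma clampR_itv r : 0 <= clampR r <= 1.
Proof. by rewrite /clampR; case: (leP 0 (Num.min 1 r)); case: (leP 1 r) => ? ?; apply/andP; split; lra. Qed.

Lemma clampR_id r : 0 <= r <= 1 -> clampR r = r.
Proof. by move=> /andP[? ?]; rewrite /clampR; case: (leP 0 (Num.min 1 r)); case: (leP 1 r) => ? ?; lra. Qed.

Lemma clampR_le0 r : r <= 0 -> clampR r = 0.
Proof. by move=> ?; rewrite /clampR; case: (leP 0 (Num.min 1 r)); case: (leP 1 r) => ? ?; lra. Qed.

Lemma clampR_ge1 r : 1 <= r -> clampR r = 1.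
Proof. by move=> ?; rewrite /clampR; case: (leP 0 (Num.min 1 r)); case: (leP 1 r) => ? ?; lra. Qed.

Lemma clampR_clampR r : clampR (clampR r) = clampR r.
Proof. exact: clampR_id (clampR_itv r). Qed.

Lemma clampR_near t s e : 0 < e -> t - e < s < t + e ->
  clampR t - e < clampR s < clampR t + e.
Proof.
move=> e0; have := clampR_itv s; have := clampR_itv t.
have [h|h] := leP t 0; have [k|k] := leP s 0.
- by rewrite !clampR_le0 //; lra.
- rewrite (clampR_le0 t) //; have [k'|k'] := leP s 1; first by rewrite clampR_id; lra.
  by rewrite clampR_ge1; lra.
- rewrite (clampR_le0 s) //; have [k'|k'] := leP t 1; first by rewrite clampR_id; lra.
  by rewrite clampR_ge1; lra.
- have [h'|h'] := leP t 1; have [k'|k'] := leP s 1.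
  + by rewrite !clampR_id; lra.
  + by rewrite (clampR_id t) ?(clampR_ge1 s); lra.
  + by rewrite (clampR_id s) ?(clampR_ge1 t); lra.
  + by rewrite !clampR_ge1; lra.
Qed.

(** The affine path from [a] to [b], frozen outside the unit interval: all its values stay between
    [a] and [b], so a statement about an interval can be tested on a function of the whole line. *)
Definition seg (a b r : RR) : RR := a + clampR r * (b - a).

Lemma seg0 a b : seg a b 0 = a.
Proof. by rewrite /seg clampR_le0 // mul0r addr0. Qed.

Lemma seg1 a b : seg a b 1 = b.
Proof. by rewrite /seg clampR_ge1 // mul1r addrC subrK. Qed.

Lemma seg_cc a b c d r : c <= a <= d -> c <= b <= d -> c <= seg a b r <= d.
Proof. by rewrite /seg => ? ?; have /andP[? ?] := clampR_itv r; nra. Qed.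

Lemma seg_oo a b c d r : c < a < d -> c < b < d -> c < seg a b r < d.
Proof.
move=> ha hb; have [ab|ba] := leP a b.
  by have := seg_cc a b a b r; lra.
by have := seg_cc a b b a r; lra.
Qed.

Lemma clampR_rev r : clampR (1 - r) = 1 - clampR r.
Proof.
have [h|h] := leP r 0; first by rewrite (clampR_le0 r) // clampR_ge1; lra.
have [h'|h'] := leP r 1; first by rewrite !clampR_id; lra.
by rewrite (clampR_ge1 r) ?clampR_le0; lra.
Qed.

Lemma rcont_clampR {A : Type} {OA : set (set A)} (f : A -> RR) : is_topology OA ->
  rcont OA (@open RR) f -> rcont OA (@open RR) (fun x => clampR (f x)).
Proof.
by move=> hA hf; apply: rcont_max => //; [apply: rcont_cst|apply: rcont_min => //; apply: rcont_cst].
Qed.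

Definition clamp (r : RR) : I := exist _ (clampR r) (clampR_itv r).

Lemma I_eq (s t : I) : proj1_sig s = proj1_sig t -> s = t.
Proof. by case: s t => [s hs] [t ht] /= e; apply: eq_exist. Qed.

Lemma clampK (t : I) : clamp (proj1_sig t) = t.
Proof. by apply: I_eq; rewrite /= clampR_id //; case: t. Qed.

Lemma clamp_le0 r : r <= 0 -> clamp r = i0.
Proof. by move=> h; apply: I_eq; rewrite /= clampR_le0. Qed.

Lemma clamp_ge1 r : 1 <= r -> clamp r = i1.
Proof. by move=> h; apply: I_eq; rewrite /= clampR_ge1. Qed.

Lemma clamp_clampR r : clamp (clampR r) = clamp r.
Proof. by apply: I_eq; rewrite /= clampR_clampR. Qed.

Lemma rcont_val : rcont I_top (@open RR) (@proj1_sig _ _).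
Proof. by move=> V OV; exists V. Qed.

Lemma rcont_clamp {A : Type} {OA : set (set A)} (f : A -> RR) : is_topology OA ->
  rcont OA (@open RR) f -> rcont OA I_top (fun x => clamp (f x)).
Proof.
by move=> hA hf _ [V [OV ->]]; apply: (rcont_clampR _ _ _ V OV).
Qed.

Lemma rcont_seg a b : rcont (@open RR) (@open RR) (seg a b).
Proof.
have hR := open_is_topology RR; apply: rcontD => //; first exact: rcont_cst.
by apply: rcontM; [|apply: rcont_clampR|apply: rcont_cst].
Qed.

(** * Paths and the fundamental group *)

Record is_group {G : Type} (mul : G -> G -> G) (inv : G -> G) (one : G) : Prop := IsGroup {
  grp_mulA : forall x y z, mul x (mul y z) = mul (mul x y) z;
  grp_mul1l : forall x, mul one x = x;
  grp_mulVl : forall x, mul (inv x) x = one }.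

Section group_laws.
Context {G : Type} {mul : G -> G -> G} {inv : G -> G} {one : G}.
Hypothesis hG : is_group mul inv one.

Lemma grp_mulVr x : mul x (inv x) = one.
Proof.
rewrite -[LHS](grp_mul1l _ _ _ hG) -{1}(grp_mulVl _ _ _ hG (inv x)).
rewrite -(grp_mulA _ _ _ hG) (grp_mulA _ _ _ hG (inv x)) (grp_mulVl _ _ _ hG).
by rewrite (grp_mul1l _ _ _ hG) (grp_mulVl _ _ _ hG).
Qed.

Lemma grp_mul1r x : mul x one = x.
Proof. by rewrite -(grp_mulVl _ _ _ hG x) (grp_mulA _ _ _ hG) grp_mulVr (grp_mul1l _ _ _ hG). Qed.

Lemma grp_mulK x y : mul (mul x y) (inv y) = x.
Proof. by rewrite -(grp_mulA _ _ _ hG) grp_mulVr grp_mul1r. Qed.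

Lemma grp_mulVK x y : mul (mul x (inv y)) y = x.
Proof. by rewrite -(grp_mulA _ _ _ hG) (grp_mulVl _ _ _ hG) grp_mul1r. Qed.

Lemma grp_mulI x y z : mul x y = mul z y -> x = z.
Proof. by move=> e; rewrite -(grp_mulK x y) e grp_mulK. Qed.

Lemma grp_inv_uniq x y : mul x y = one -> x = inv y.
Proof. by move=> e; apply: (grp_mulI _ y); rewrite e (grp_mulVl _ _ _ hG). Qed.
End group_laws.

Section group_morphisms.
Context {G H : Type} {mulG : G -> G -> G} {invG : G -> G} {oneG : G}
  {mulH : H -> H -> H} {invH : H -> H} {oneH : H}.
Hypotheses (hG : is_group mulG invG oneG) (hH : is_group mulH invH oneH).
Context (f : G -> H).
Hypothesis fM : forall x y, f (mulG x y) = mulH (f x) (f y).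

Lemma grp_hom1 : f oneG = oneH.
Proof.
apply: (grp_mulI hH _ (f oneG)).
by rewrite -fM (grp_mul1l _ _ _ hG) (grp_mul1l _ _ _ hH).
Qed.

Lemma grp_homV x : f (invG x) = invH (f x).
Proof. by apply: (grp_inv_uniq hH); rewrite -fM (grp_mulVl _ _ _ hG) grp_hom1. Qed.
End group_morphisms.

Definition rr_top : set (set (RR * RR)) := prod_top open open.

Lemma rr_top_is_topology : is_topology rr_top.
Proof. exact: prod_top_is_topology. Qed.

Lemma rr_fst : rcont rr_top (@open RR) fst.
Proof. by apply: rcont_fst; exact: open_is_topology. Qed.

Lemma rr_snd : rcont rr_top (@open RR) snd.
Proof. by apply: rcont_snd; exact: open_is_topology. Qed.

Ltac rcont_real := repeat first
  [ exact: rcont_id | exact: rcont_fst | exact: rcont_snd | exact: rcont_val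
  | exact: open_is_topology | exact: prod_top_is_topology | exact: I_top_is_topology
  | exact: rr_top_is_topology | exact: rr_fst | exact: rr_snd
  | assumption
  | apply: rcont_clamp | apply: rcont_clampR
  | apply: rcont_min | apply: rcont_max
  | apply: rcontD | apply: rcontM | apply: rcontN | apply: rcont_cst ].

Lemma rcont_rr_pair {A : Type} {OA : set (set A)} (f g : A -> RR) : is_topology OA ->
  rcont OA (@open RR) f -> rcont OA (@open RR) g -> rcont OA rr_top (fun x => (f x, g x)).
Proof. by move=> hA hf hg; apply: rcont_pair. Qed.

Section paths.
Context {Y : Type} {OY : set (set Y)}.
Implicit Types p q : RR -> Y.
Notation path p := (rcont (@open RR) OY p).
Local Hint Resolve rr_top_is_topology rr_fst rr_snd open_is_topology : core.

(* Paths are total functions on the reals, of which only the restriction to [[0, 1]] matters;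
   no truncation is then needed to reparametrize or concatenate them. *)
Definition phtpy p q : Prop := exists H : RR * RR -> Y,
  [/\ rcont rr_top OY H, forall s, H (s, 0) = p s, forall s, H (s, 1) = q s,
      forall t, H (0, t) = p 0 & forall t, H (1, t) = p 1].

Lemma phtpy_refl p : path p -> phtpy p p.
Proof. by move=> hp; exists (fun x => p x.1); split=> //; apply: rcont_comp hp _. Qed.

Lemma phtpy_sym p q : phtpy p q -> phtpy q p.
Proof.
case=> H [hH H0 H1 Hl Hr]; exists (fun x => H (x.1, 1 - x.2)); split=> [|s|s|t|t] /=.
- by apply: rcont_comp hH _; apply: rcont_rr_pair => //; rcont_real.
- by rewrite subr0.
- by rewrite subrr.
- by rewrite Hl -H1 Hl.
- by rewrite Hr -H1 Hr.
Qed.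

Lemma phtpy_trans p q r : phtpy p q -> phtpy q r -> phtpy p r.
Proof.
case=> H [hH H0 H1 Hl Hr] [K [hK K0 K1 Kl Kr]].
exists (fun x => if x.2 <= 1/2 then H (x.1, 2 * x.2) else K (x.1, 2 * x.2 - 1)).
split=> [|s|s|t|t] /=.
- apply: (rcont_paste _ snd (1/2) (fun x => H (x.1, 2 * x.2)) (fun x => K (x.1, 2 * x.2 - 1))) => //.
  + by apply: rcont_comp hH _; apply: rcont_rr_pair => //; rcont_real.
  + by apply: rcont_comp hK _; apply: rcont_rr_pair => //; rcont_real.
  + move=> [s t] /= ->; rewrite (_ : 2 * (1/2) = 1); last lra.
    by rewrite subrr K0 H1.
- by rewrite ifT ?mulr0//; lra.
- rewrite ifF; first by rewrite (_ : 2 * 1 - 1 = 1) //; lra.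
  by apply/negbTE; lra.
- by case: ifP => _; rewrite ?Hl // Kl -H1 Hl.
- by case: ifP => _; rewrite ?Hr // Kr -H1 Hr.
Qed.

(** Straight-line homotopy from [phi] to [psi]. Its values may leave the unit interval, which is
    harmless since [p] is defined on the whole line. *)
Lemma phtpy_reparam p (phi psi : RR -> RR) : path p ->
  rcont open open phi -> rcont open open psi -> phi 0 = psi 0 -> phi 1 = psi 1 ->
  phtpy (fun s => p (phi s)) (fun s => p (psi s)).
Proof.
move=> hp hphi hpsi e0 e1.
exists (fun x => p ((1 - x.2) * phi x.1 + x.2 * psi x.1)); split=> [|s|s|t|t] /=.
- apply: rcont_comp hp _.
  have h1 : rcont rr_top (@open RR) (fun x => phi x.1) by apply: rcont_comp hphi _.
  have h2 : rcont rr_top (@open RR) (fun x => psi x.1) by apply: rcont_comp hpsi _.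
  by rcont_real.
- by congr p; lra.
- by congr p; lra.
- by rewrite -e0; congr p; lra.
- by rewrite -e1; congr p; lra.
Qed.

Definition concat p q (r : RR) : Y := if r <= 1/2 then p (2 * r) else q (2 * r - 1).

Lemma concat0 p q : concat p q 0 = p 0.
Proof. by rewrite /concat ifT ?mulr0//; lra. Qed.

Lemma concat1 p q : concat p q 1 = q 1.
Proof.
rewrite /concat ifF; first by congr q; lra.
by apply/negbTE; lra.
Qed.

Lemma path_concat p q : path p -> path q -> p 1 = q 0 -> path (concat p q).
Proof.
move=> hp hq e.
apply: (rcont_paste _ id (1/2) (fun r => p (2 * r)) (fun r => q (2 * r - 1))) => //.
- by apply: rcont_comp hp _; rcont_real.
- by apply: rcont_comp hq _; rcont_real.
- move=> r -> /=; rewrite (_ : 2 * (1/2) = 1); last lra.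
  by rewrite e; congr q; lra.
Qed.

Lemma phtpy_concat p q p' q' : phtpy p p' -> phtpy q q' -> p 1 = q 0 ->
  phtpy (concat p q) (concat p' q').
Proof.
case=> H [hH H0 H1 Hl Hr] [K [hK K0 K1 Kl Kr]] e.
exists (fun x => if x.1 <= 1/2 then H (2 * x.1, x.2) else K (2 * x.1 - 1, x.2)).
split=> [|s|s|t|t] /=.
- apply: (rcont_paste _ fst (1/2) (fun x => H (2 * x.1, x.2)) (fun x => K (2 * x.1 - 1, x.2))) => //.
  + by apply: rcont_comp hH _; apply: rcont_rr_pair => //; rcont_real.
  + by apply: rcont_comp hK _; apply: rcont_rr_pair => //; rcont_real.
  + move=> [s t] /= ->; rewrite (_ : 2 * (1/2) = 1); last lra.
    by rewrite subrr Hr Kl.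
- by rewrite H0 K0.
- by rewrite H1 K1.
- by rewrite concat0 ifT ?mulr0 //; lra.
- rewrite concat1 ifF; first by rewrite -(Kr t); congr (K (_, _)); lra.
  by apply/negbTE; lra.
Qed.

Lemma concatA p q r : path p -> path q -> path r -> p 1 = q 0 -> q 1 = r 0 ->
  phtpy (concat (concat p q) r) (concat p (concat q r)).
Proof.
move=> hp hq hr e1 e2.
(* Piecewise linear with slopes 2, 1, 1/2 and breaks at 1/4 and 1/2; being concave, it is the
   minimum of its affine pieces. *)
pose phi t : RR := Num.min (2 * t) (Num.min (t + 1/4) ((t + 1) / 2)).
have -> : concat (concat p q) r = fun t => concat p (concat q r) (phi t).
  apply/funext => t; rewrite /phi.
  have [h1|h1] := leP t (1/4).
    have -> : Num.min (2 * t) (Num.min (t + 1 / 4) ((t + 1) / 2)) = 2 * t.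
      by case: (leP (2 * t)); case: (leP (t + 1/4)); lra.
    by rewrite /concat !ifT //; lra.
  have [h2|h2] := leP t (1/2).
    have -> : Num.min (2 * t) (Num.min (t + 1 / 4) ((t + 1) / 2)) = t + 1/4.
      by case: (leP (2 * t)); case: (leP (t + 1/4)); lra.
    rewrite /concat ifT //; rewrite ifF; last by apply/negbTE; lra.
    rewrite ifF; last by apply/negbTE; lra.
    by rewrite ifT; [congr (q _)|]; lra.
  have -> : Num.min (2 * t) (Num.min (t + 1 / 4) ((t + 1) / 2)) = (t + 1) / 2.
    by case: (leP (2 * t)); case: (leP (t + 1/4)); lra.
  rewrite /concat ifF; last by apply/negbTE; lra.
  rewrite ifF; last by apply/negbTE; lra.
  rewrite ifF; last by apply/negbTE; lra.
  by congr (r _); lra.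
have hc : path (concat p (concat q r)).
  by apply: path_concat => //; [exact: path_concat|rewrite concat0].
apply: (@phtpy_reparam (concat p (concat q r)) phi id) => //.
- by rewrite /phi; rcont_real.
- by rewrite /phi /=; case: (leP (2 * _)); case: (leP (_ + 1/4)); lra.
- by rewrite /phi /=; case: (leP (2 * _)); case: (leP (_ + 1/4)); lra.
Qed.

Lemma concat1p p : path p -> phtpy (concat (fun=> p 0) p) p.
Proof.
move=> hp.
have -> : concat (fun=> p 0) p = fun t => p (Num.max 0 (2 * t - 1)).
  apply/funext => t; rewrite /concat.
  by case: (leP t (1/2)) => h1; case: (leP 0 (2 * t - 1)) => h2; congr (p _); lra.
apply: (@phtpy_reparam p (fun t => Num.max 0 (2 * t - 1)) id) => //; first by rcont_real.
- by case: leP; lra.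
- by case: leP; lra.
Qed.

(** The concatenation runs along [p] at the parameter [|2 t - 1|], which starts and ends at 1 and so
    deforms to the constant 1. *)
Lemma concatVp p : path p -> phtpy (concat (fun r => p (1 - r)) p) (fun=> p 1).
Proof.
move=> hp.
have -> : concat (fun r => p (1 - r)) p = fun t => p (Num.max (1 - 2 * t) (2 * t - 1)).
  apply/funext => t; rewrite /concat.
  by case: (leP t (1/2)) => h1; case: (leP (1 - 2 * t) (2 * t - 1)) => h2; congr (p _); lra.
apply: (@phtpy_reparam p (fun t => Num.max (1 - 2 * t) (2 * t - 1)) (fun=> 1)) => //; rcont_real.
- by case: leP; lra.
- by case: leP; lra.
Qed.

End paths.

Section fundamental_group.
Context {Y : Type} {OY : set (set Y)} {y0 : Y}.
Implicit Types (p q : RR -> Y) (a b c : loop OY y0).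
Notation path p := (rcont (@open RR) OY p).
Local Notation pi1Y := (pi1 OY y0).

Definition rloop (p : RR -> Y) : Prop := [/\ path p, p 0 = y0 & p 1 = y0].

Lemma rloop_is_loop {p} : rloop p -> is_loop OY y0 (fun t => p (proj1_sig t)).
Proof. by case=> hp p0 p1; split=> //; apply: rcont_comp hp rcont_val. Qed.

Definition mkloop {p} (h : rloop p) : loop OY y0 :=
  exist _ (fun t => p (proj1_sig t)) (rloop_is_loop h).

Definition loopR a : RR -> Y := fun r => proj1_sig a (clamp r).

Lemma rloop_loopR a : rloop (loopR a).
Proof.
case: a => a [ha a0 a1]; split; rewrite /loopR /=.
- by apply: rcont_comp ha _; rcont_real.
- by rewrite clamp_le0.
- by rewrite clamp_ge1.
Qed.

Lemma loop_homotopicP a b : loop_homotopic OY y0 a b <-> phtpy (OY := OY) (loopR a) (loopR b).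
Proof.
have [_ a0 a1] := rloop_loopR a.
split=> -[H [hH H0 H1 Hl Hr]].
  exists (fun x => H (clamp x.1, clamp x.2)); split=> [|s|s|t|t] /=.
  - apply: rcont_comp hH _; apply: rcont_pair; rcont_real.
  - by rewrite (clamp_le0 0) // H0.
  - by rewrite (clamp_ge1 1) // H1.
  - by rewrite (clamp_le0 0) // Hl a0.
  - by rewrite (clamp_ge1 1) // Hr a1.
exists (fun x => H (proj1_sig x.1, proj1_sig x.2)); split=> [|s|s|t|t] /=.
- have hI := I_top_is_topology.
  apply: rcont_comp hH _; apply: rcont_rr_pair; first exact: prod_top_is_topology.
    by apply: rcont_comp rcont_val _; exact: rcont_fst.
  by apply: rcont_comp rcont_val _; exact: rcont_snd.
- by rewrite H0 /loopR clampK.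
- by rewrite H1 /loopR clampK.
- by rewrite Hl a0.
- by rewrite Hr a1.
Qed.

Lemma pi1_cls_eq a b : pi1_cls a = pi1_cls b <-> phtpy (OY := OY) (loopR a) (loopR b).
Proof.
split=> [h|/loop_homotopicP h].
  apply/loop_homotopicP; apply: qcls_inj h => x; apply/loop_homotopicP; apply: phtpy_refl.
  by case: (rloop_loopR x).
apply: qcls_eq h => [x y|x y z] /loop_homotopicP h.
  exact/loop_homotopicP/phtpy_sym.
by move=> /loop_homotopicP h'; apply/loop_homotopicP; apply: phtpy_trans h h'.
Qed.

(** Total, with the neutral class as default, so that representatives can be rewritten inside it
    without carrying proofs that they are loops. *)
Definition pcls p : pi1Y :=
  match pselect (rloop p) with left h => pi1_cls (mkloop h) | right _ => pi1_one OY y0 end.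

Lemma pclsE p (h : rloop p) : pcls p = pi1_cls (mkloop h).
Proof. by rewrite /pcls; case: pselect => // h'; congr (pi1_cls (mkloop _)). Qed.

Lemma loopR_mkloop p (h : rloop p) : loopR (mkloop h) = fun r => p (clampR r).
Proof. by []. Qed.

Lemma rloop_clampR p : rloop p -> rloop (fun r => p (clampR r)).
Proof.
case=> hp p0 p1; split; first by apply: rcont_comp hp _; rcont_real.
- by rewrite clampR_le0.
- by rewrite clampR_ge1.
Qed.

Lemma pcls_ext p q : rloop p -> rloop q -> (forall r, 0 <= r <= 1 -> p r = q r) ->
  pcls p = pcls q.
Proof.
move=> hp hq e; rewrite !pclsE; congr pi1_cls; apply: eq_exist.
by apply/funext => -[t ht] /=; apply: e.
Qed.

Lemma pcls_phtpy p q : rloop p -> rloop q -> phtpy (OY := OY) p q -> pcls p = pcls q.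
Proof.
move=> hp hq [H [hH H0 H1 Hl Hr]]; rewrite !pclsE; apply/pi1_cls_eq; rewrite !loopR_mkloop.
exists (fun x => H (clampR x.1, x.2)); split=> //= [|t|t].
- apply: rcont_comp hH _; apply: rcont_rr_pair; rcont_real.
- by rewrite clampR_le0.
- by rewrite clampR_ge1.
Qed.

Lemma pcls_inj p q : rloop p -> rloop q -> pcls p = pcls q ->
  phtpy (OY := OY) (fun r => p (clampR r)) (fun r => q (clampR r)).
Proof. by move=> hp hq; rewrite !pclsE => /pi1_cls_eq. Qed.

Lemma pcls_loopR a : pcls (loopR a) = pi1_cls a.
Proof.
rewrite pclsE; first exact: rloop_loopR.
move=> h; congr pi1_cls; case: a h => a ha h; apply: eq_exist.
by apply/funext => t; rewrite /= /loopR /= clampK.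
Qed.

Lemma pcls_surj (A : pi1Y) : exists2 p, rloop p & A = pcls p.
Proof.
exists (loopR (qrep A)); first exact: rloop_loopR.
by rewrite pcls_loopR /pi1_cls qrepK.
Qed.

Lemma rloop_cst : rloop (fun=> y0).
Proof. by split=> //; rcont_real. Qed.

Lemma pcls_cst : pcls (fun=> y0) = pi1_one OY y0.
Proof. by rewrite pclsE; [exact: rloop_cst|move=> h; congr pi1_cls; apply: eq_exist]. Qed.

Lemma rloop_concat p q : rloop p -> rloop q -> rloop (concat p q).
Proof.
move=> [hp p0 p1] [hq q0 q1]; split; rewrite ?concat0 ?concat1 //.
by apply: path_concat; rewrite // p1 q0.
Qed.

Lemma pcls_concat p q p' q' : rloop p -> rloop q -> rloop p' -> rloop q' ->
  pcls p = pcls p' -> pcls q = pcls q' -> pcls (concat p q) = pcls (concat p' q').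
Proof.
move=> hp hq hp' hq' ep eq.
have aux u v : rloop u -> rloop v ->
    pcls (concat u v) = pcls (concat (fun r => u (clampR r)) (fun r => v (clampR r))).
  move=> hu hv; apply: pcls_ext.
  - exact: rloop_concat.
  - by apply: rloop_concat; apply: rloop_clampR.
  - move=> r /andP[r0 r1]; rewrite /concat; case: (leP r (1/2)) => h.
      by rewrite clampR_id //; lra.
    by rewrite clampR_id //; lra.
rewrite (aux p q) // (aux p' q') //; apply: pcls_phtpy.
- by apply: rloop_concat; apply: rloop_clampR.
- by apply: rloop_concat; apply: rloop_clampR.
apply: phtpy_concat; [exact: pcls_inj|exact: pcls_inj|].
by rewrite clampR_ge1 // clampR_le0 //; case: hp hq => _ _ -> [].
Qed.

(** [pi1_mul] picks the class of some concatenation of some representatives; every pick gives the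
    same class because concatenation respects homotopy. *)
Lemma pi1_mulE p q : rloop p -> rloop q -> pi1_mul OY y0 (pcls p) (pcls q) = pcls (concat p q).
Proof.
move=> hp hq; rewrite /pi1_mul /Defs.choose; case: pselect => [h|[]].
  case: cid => C /= [a [b [c [ea eb -> ec]]]].
  rewrite -(pcls_loopR a) in ea; rewrite -(pcls_loopR b) in eb.
  rewrite (pcls_concat p q (loopR a) (loopR b)) //; try exact: rloop_loopR.
  rewrite -pcls_loopR; apply: pcls_ext; first exact: rloop_loopR.
    by apply: rloop_concat; exact: rloop_loopR.
  move=> r hr; rewrite /concat /loopR; case: (leP r (1/2)) => h1.
    by apply: (ec (clamp r) (clamp (2 * r))).1; rewrite /= !clampR_id //; lra.
  by apply: (ec (clamp r) (clamp (2 * r - 1))).2; rewrite /= !clampR_id //; lra.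
have hpq := rloop_concat _ _ hp hq.
exists (pi1_cls (mkloop hpq)), (mkloop hp), (mkloop hq), (mkloop hpq).
rewrite -!pclsE; split=> // -[t ht] [s hs]; split=> /= h1 h2.
  by rewrite h2 /concat h1.
rewrite h2 /concat; case: leP => // h3.
have -> : t = 1/2 by lra.
case: hp hq => [_ _ e1] [_ e2 _].
by rewrite (_ : 2 * (1/2) = 1); last lra; rewrite subrr e1 e2.
Qed.

Lemma rloop_rev p : rloop p -> rloop (fun r => p (1 - r)).
Proof.
case=> hp p0 p1; split; first by apply: rcont_comp hp _; rcont_real.
- by rewrite subr0.
- by rewrite subrr.
Qed.

Lemma pi1_invE p : rloop p -> pi1_inv OY y0 (pcls p) = pcls (fun r => p (1 - r)).
Proof.
move=> hp; rewrite /pi1_inv /Defs.choose; case: pselect => [h|[]].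
  case: cid => C /= [a [c [ea -> ec]]].
  have hr := rloop_rev _ (rloop_clampR _ hp).
  transitivity (pcls (fun r => p (clampR (1 - r)))); last first.
    apply: pcls_ext => //; first exact: rloop_rev.
    by move=> r hr'; rewrite clampR_id //; lra.
  rewrite -(pcls_loopR a) in ea.
  have [H [hH H0 H1 Hl Hr]] := pcls_inj _ _ hp (rloop_loopR a) ea.
  rewrite -pcls_loopR; symmetry; apply: pcls_phtpy => //; first exact: rloop_loopR.
  exists (fun x => H (1 - x.1, x.2)); split=> [|s|s|t|t] /=.
  - apply: rcont_comp hH _; apply: rcont_rr_pair; rcont_real.
  - by rewrite H0.
  - rewrite H1 /loopR; symmetry; apply: ec => /=.
    by rewrite clampR_clampR clampR_rev.
  - by rewrite subr0 Hr.
  - by rewrite subrr Hl.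
have hr := rloop_rev _ hp.
exists (pi1_cls (mkloop hr)), (mkloop hp), (mkloop hr).
by rewrite -!pclsE; split=> // -[t ht] [s hs] /= ->.
Qed.

Lemma pi1_is_group : is_group (pi1_mul OY y0) (pi1_inv OY y0) (pi1_one OY y0).
Proof.
split.
- move=> x y z; have [p hp ->] := pcls_surj x; have [q hq ->] := pcls_surj y.
  have [r hr ->] := pcls_surj z.
  have hpq := rloop_concat _ _ hp hq; have hqr := rloop_concat _ _ hq hr.
  rewrite !pi1_mulE //; symmetry; apply: pcls_phtpy; [exact: rloop_concat..|].
  by case: hp hq hr => [? ? ?] [? ? ?] [? ? ?]; apply: concatA => //; congruence.
- move=> x; have [p hp ->] := pcls_surj x.
  have hc := rloop_cst; rewrite -pcls_cst pi1_mulE //.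
  apply: pcls_phtpy => //; first exact: rloop_concat.
  by case: hp => hp p0 _; rewrite -p0; apply: concat1p.
- move=> x; have [p hp ->] := pcls_surj x; have hr := rloop_rev _ hp.
  rewrite pi1_invE // pi1_mulE // -pcls_cst.
  apply: pcls_phtpy; [exact: rloop_concat|exact: rloop_cst|].
  by case: hp => hp _ p1; rewrite -p1; apply: concatVp.
Qed.
End fundamental_group.

Lemma rloop_comp {Y Y' : Type} {OY : set (set Y)} {OY' : set (set Y')} {y0 : Y}
    (g : Y -> Y') (p : RR -> Y) : rcont OY OY' g -> rloop (OY := OY) (y0 := y0) p ->
  rloop (OY := OY') (y0 := g y0) (fun r => g (p r)).
Proof. by move=> hg [hp p0 p1]; split; rewrite ?p0 ?p1 //; apply: rcont_comp hg hp. Qed.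

Lemma pi1_mapE {Y Y' : Type} {OY : set (set Y)} {OY' : set (set Y')} {y0 : Y} {y0' : Y'} (g : Y -> Y')
    (p : RR -> Y) : rcont OY OY' g -> g y0 = y0' -> rloop (OY := OY) (y0 := y0) p ->
  pi1_map OY y0 OY' y0' g (pcls p) = pcls (fun r => g (p r)).
Proof.
move=> hg <- hp; rewrite /pi1_map /Defs.choose; case: pselect => [h|[]].
  case: cid => C /= [a [c [ea -> ec]]].
  rewrite -(pcls_loopR a) in ea.
  have hgp := rloop_comp _ _ hg hp.
  transitivity (pcls (OY := OY') (y0 := g y0) (fun r => g (p (clampR r)))); last first.
    by apply: pcls_ext => //; [exact: (rloop_clampR _ hgp)|move=> r hr'; rewrite clampR_id].
  have [H [hH H0 H1 Hl Hr]] := pcls_inj _ _ hp (rloop_loopR a) ea.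
  rewrite -pcls_loopR; symmetry; apply: pcls_phtpy => //; [exact: (rloop_clampR _ hgp)|exact: rloop_loopR|].
  exists (fun x => g (H x)); split=> [|s|s|t|t].
  - exact: rcont_comp hg hH.
  - by rewrite H0.
  - by rewrite H1 /loopR ec clamp_clampR.
  - by rewrite Hl.
  - by rewrite Hr.
have hr := rloop_comp _ _ hg hp.
exists (pi1_cls (mkloop hr)), (mkloop hp), (mkloop hr).
by rewrite -!pclsE; split.
Qed.

Lemma pi1_map_hom {Y Y' : Type} {OY : set (set Y)} {OY' : set (set Y')} {y0 : Y} {y0' : Y'} (g : Y -> Y')
    (A B : pi1 OY y0) : rcont OY OY' g -> g y0 = y0' ->
  pi1_map OY y0 OY' y0' g (pi1_mul OY y0 A B) =
  pi1_mul OY' y0' (pi1_map OY y0 OY' y0' g A) (pi1_map OY y0 OY' y0' g B).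
Proof.
move=> hg <-; have [p hp ->] := pcls_surj A; have [q hq ->] := pcls_surj B.
rewrite pi1_mulE // !pi1_mapE //; last exact: rloop_concat.
have hgp := rloop_comp _ _ hg hp; have hgq := rloop_comp _ _ hg hq.
rewrite pi1_mulE //; congr (pcls _).
by apply/funext => r; rewrite /concat; case: ifP.
Qed.

(** * Free groups and group topologies *)

Lemma word_eqv_refl {S : Type} (u : word S) : word_eqv u u. Proof. exact: rst_refl. Qed.

Lemma word_eqv_sym {S : Type} (u v : word S) : word_eqv u v -> word_eqv v u.
Proof. exact: rst_sym. Qed.

Lemma word_eqv_trans {S : Type} (u v w : word S) :
  word_eqv u v -> word_eqv v w -> word_eqv u w.
Proof. exact: rst_trans. Qed.

Section free_group.
Context {S : Type}.
Implicit Types u v : word S.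

Lemma FG_cls_eq u v : FG_cls u = FG_cls v <-> word_eqv u v.
Proof.
split; first exact/qcls_inj/word_eqv_refl.
by apply: qcls_eq; [exact: word_eqv_sym|exact: word_eqv_trans].
Qed.

Lemma FG_surj (A : FG S) : exists u, A = FG_cls u.
Proof. by exists (qrep A); rewrite /FG_cls qrepK. Qed.

Lemma word_eqv_map {S' : Type} (F : word S -> word S') :
  (forall u v, red1 u v -> word_eqv (F u) (F v)) ->
  forall u v, word_eqv u v -> word_eqv (F u) (F v).
Proof.
move=> h u v; elim=> [x y|x|x y _|x y z _ + _].
- exact: h.
- exact: word_eqv_refl.
- exact: word_eqv_sym.
- exact: word_eqv_trans.
Qed.

Lemma word_eqv_cat u v u' v' : word_eqv u u' -> word_eqv v v' -> word_eqv (u ++ v) (u' ++ v').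
Proof.
move=> hu hv; apply: (word_eqv_trans _ (u' ++ v)).
  apply: (word_eqv_map (cat^~ v)) hu => _ _ [w1 [w2 [s [b [-> ->]]]]].
  by apply: rst_step; exists w1, (w2 ++ v), s, b; rewrite -!catA.
apply: (word_eqv_map (cat u')) hv => _ _ [w1 [w2 [s [b [-> ->]]]]].
by apply: rst_step; exists (u' ++ w1), w2, s, b; rewrite !catA.
Qed.

Definition word_inv u : word S := rev (map (fun p : S * bool => (p.1, ~~ p.2)) u).

Lemma word_eqv_inv u v : word_eqv u v -> word_eqv (word_inv u) (word_inv v).
Proof.
apply: (word_eqv_map word_inv) => {u v} _ _ [w1 [w2 [s [b [-> ->]]]]].
apply: rst_step; exists (word_inv w2), (word_inv w1), s, b.
rewrite /word_inv !map_cat /= !rev_cat; split=> //.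
by rewrite !rev_cons negbK -!cats1 -!catA.
Qed.

Lemma qrep_FG_cls u : word_eqv (qrep (FG_cls u)) u.
Proof. by apply/FG_cls_eq; rewrite /FG_cls qrepK. Qed.

Lemma FG_mulE u v : FG_mul (FG_cls u) (FG_cls v) = FG_cls (u ++ v).
Proof. by apply/FG_cls_eq; apply: word_eqv_cat; exact: qrep_FG_cls. Qed.

Lemma FG_invE u : FG_inv (FG_cls u) = FG_cls (word_inv u).
Proof. by apply/FG_cls_eq; apply: word_eqv_inv; exact: qrep_FG_cls. Qed.

Lemma word_invl u : word_eqv (word_inv u ++ u) [::].
Proof.
elim: u => [|[s b] u IH]; first exact: word_eqv_refl.
apply: word_eqv_trans IH; apply: rst_step.
exists (word_inv u), u, s, (~~ b); split=> //.
by rewrite /word_inv /= rev_cons -cats1 -catA negbK.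
Qed.

Lemma FG_is_group : is_group (@FG_mul S) FG_inv FG_one.
Proof.
split.
- move=> x y z; have [u ->] := FG_surj x; have [v ->] := FG_surj y; have [w ->] := FG_surj z.
  by rewrite !FG_mulE catA.
- by move=> x; have [u ->] := FG_surj x; rewrite FG_mulE.
- by move=> x; have [u ->] := FG_surj x; rewrite FG_invE FG_mulE; apply/FG_cls_eq/word_invl.
Qed.

Section extension.
Context {G : Type} {mul : G -> G -> G} {inv : G -> G} {one : G}.
Hypothesis hG : is_group mul inv one.
Context (phi : S -> G).

Definition word_ext u : G :=
  foldr (fun p acc => mul (if p.2 then phi p.1 else inv (phi p.1)) acc) one u.

Definition FG_ext (A : FG S) : G := word_ext (qrep A).

Lemma word_ext_cat u v : word_ext (u ++ v) = mul (word_ext u) (word_ext v).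
Proof.
elim: u => [|p u IH] /=; first by rewrite (grp_mul1l _ _ _ hG).
by rewrite IH (grp_mulA _ _ _ hG).
Qed.

Lemma word_ext_eqv u v : word_eqv u v -> word_ext u = word_ext v.
Proof.
elim=> [_ _ [w1 [w2 [s [b [-> ->]]]]]|//|x y _ -> //|x y z _ -> _ -> //].
rewrite !word_ext_cat; congr mul => /=.
rewrite (grp_mulA _ _ _ hG).
by case: b => /=; rewrite ?(grp_mulVr hG) ?(grp_mulVl _ _ _ hG) (grp_mul1l _ _ _ hG).
Qed.

Lemma FG_extE u : FG_ext (FG_cls u) = word_ext u.
Proof. exact/word_ext_eqv/qrep_FG_cls. Qed.

Lemma FG_extM A B : FG_ext (FG_mul A B) = mul (FG_ext A) (FG_ext B).
Proof.
have [u ->] := FG_surj A; have [v ->] := FG_surj B.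
by rewrite FG_mulE !FG_extE word_ext_cat.
Qed.

Lemma FG_ext_gen s : FG_ext (FG_gen s) = phi s.
Proof. by rewrite FG_extE /= (grp_mul1r hG). Qed.

Lemma FG_hom_uniq (f g : FG S -> G) :
  (forall A B, f (FG_mul A B) = mul (f A) (f B)) ->
  (forall A B, g (FG_mul A B) = mul (g A) (g B)) ->
  (forall s, f (FG_gen s) = g (FG_gen s)) -> forall A, f A = g A.
Proof.
move=> fM gM e A; have [u ->] := FG_surj A.
elim: u => [|[s b] u IH].
  by rewrite -/FG_one (grp_hom1 FG_is_group hG f fM) (grp_hom1 FG_is_group hG g gM).
rewrite -(cat1s (s, b)) -FG_mulE fM gM IH; congr mul.
case: b; first exact: e.
have -> : FG_cls [:: (s, false)] = FG_inv (FG_gen s) by rewrite FG_invE.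
by rewrite (grp_homV FG_is_group hG f fM) (grp_homV FG_is_group hG g gM) e.
Qed.
End extension.
End free_group.

Lemma FG_mapE {S S' : Type} (phi : S -> S') (u : word S) :
  FG_map phi (FG_cls u) = FG_cls (map (fun p : S * bool => (phi p.1, p.2)) u).
Proof.
apply/FG_cls_eq; apply: (word_eqv_map (map _)) (qrep_FG_cls u).
move=> _ _ [w1 [w2 [s [b [-> ->]]]]]; apply: rst_step.
exists (map (fun p : S * bool => (phi p.1, p.2)) w1),
  (map (fun p : S * bool => (phi p.1, p.2)) w2), (phi s), b.
by rewrite !map_cat.
Qed.

Lemma FG_mapM {S S' : Type} (phi : S -> S') (A B : FG S) :
  FG_map phi (FG_mul A B) = FG_mul (FG_map phi A) (FG_map phi B).
Proof.
have [u ->] := FG_surj A; have [v ->] := FG_surj B.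
by rewrite FG_mulE !FG_mapE FG_mulE map_cat.
Qed.

Section group_topologies.
Context {G : Type} {mul : G -> G -> G} {inv : G -> G} {one : G}.
Hypothesis hG : is_group mul inv one.

Lemma discrete_group_topology : group_topology mul inv setT.
Proof.
have hT : is_topology [set: set G] by [].
split=> // V _; apply/(prod_topP hT hT) => -[x y] /= h.
by exists [set x], [set y]; split=> // -[_ _] [/= -> ->].
Qed.

Lemma group_topology_pullback {H : Type} {mulH : H -> H -> H} {invH : H -> H} {oneH : H}
    (hH : is_group mulH invH oneH) (OH : set (set H)) (f : G -> H) :
  (forall x y, f (mul x y) = mulH (f x) (f y)) -> group_topology mulH invH OH ->
  group_topology mul inv [set U | exists2 V, OH V & U = f @^-1` V].
Proof.
move=> fM [tH cM cV]; have [O1 O2 O3] := tH.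
have tG : is_topology [set U | exists2 V, OH V & U = f @^-1` V].
  split.
  - by exists setT; rewrite // preimage_setT.
  - by move=> _ _ [U OU ->] [V OV ->]; exists (U `&` V); [exact: O2|].
  - move=> F hF; exists (\bigcup_(V in [set V | OH V /\ F (f @^-1` V)]) V).
      by apply: O3 => V [].
    apply/seteqP; split=> x [U FU Ux].
      have [V OV e] := hF _ FU; exists V; first by split=> //; rewrite -e.
      by move: Ux; rewrite e.
    by exists (f @^-1` U) => //; case: FU.
split=> // _ [V OV ->].
  apply/(prod_topP tG tG) => -[x y] /=; rewrite fM => Vxy.
  have [U [W [OU OW Ux Wy s]]] := (prod_topP tH tH _).1 (cM _ OV) (f x, f y) Vxy.
  exists (f @^-1` U), (f @^-1` W); split=> //=; [by exists U|by exists W|].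
  by move=> [a b] [/= Ua Wb]; rewrite fM; apply: (s (f a, f b)).
exists (invH @^-1` V); first exact: cV.
by apply/seteqP; split=> x /=; rewrite (grp_homV hG hH f fM).
Qed.
End group_topologies.

(** * The Markov topology and its universal property *)

Section free_topological_group.
Context {S : Type} {OS : set (set S)}.

Lemma FM_gen : is_topology OS -> rcont OS (FM_top OS) FG_gen.
Proof. by move=> hS; apply: rcont_gen => // V [O [_ hO OV]]; apply: hO. Qed.

(** A supremum of group topologies is one: for [V] open in a single admissible topology, the
    preimages under multiplication and inversion are already open for that topology. *)
Lemma FM_group_topology : group_topology FG_mul FG_inv (FM_top OS).
Proof.
have hT : is_topology (FM_top OS) by exact: gen_top_is_topology.
have sub V O : group_topology FG_mul FG_inv O -> rcont OS O FG_gen -> O V -> FM_top OS V.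
  by move=> hO cO OV; apply: gen_top_sub; exists O.
split=> //; apply: rcont_gen; try exact: prod_top_is_topology; try by [].
  move=> V [O [hO cO OV]]; have [tO mO _] := hO.
  apply/(prod_topP hT hT) => p /((prod_topP tO tO _).1 (mO _ OV))[U [W [OU OW Up Wp s]]].
  by exists U, W; split=> //; apply: sub hO cO _.
move=> V [O [hO cO OV]]; have [_ _ vO] := hO.
by apply: sub hO cO _; apply: vO.
Qed.

(** The pullback of [OH] along [f] is one of the admissible topologies that generate [FM_top]. *)
Lemma FM_univ {H : Type} {mulH : H -> H -> H} {invH : H -> H} {oneH : H}
    (hH : is_group mulH invH oneH) (OH : set (set H)) (f : FG S -> H) :
  (forall x y, f (FG_mul x y) = mulH (f x) (f y)) -> group_topology mulH invH OH ->
  rcont OS OH (fun s => f (FG_gen s)) -> rcont (FM_top OS) OH f.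
Proof.
move=> fM tH cf V OV; apply: gen_top_sub.
exists [set U | exists2 W, OH W & U = f @^-1` W]; split.
- exact: (group_topology_pullback FG_is_group hH OH f fM tH).
- by move=> _ [W OW ->]; apply: cf.
- by exists V.
Qed.
End free_topological_group.

(** * The topological group [tau] *)

Section tau.
Context {G : Type} {mul : G -> G -> G} {inv : G -> G} {one : G} {OG : set (set G)}.
Hypotheses (hG : is_group mul inv one) (tG : is_topology OG).
Local Notation m := (mult_epi mul inv one).
Local Notation tau := (tau_top mul inv one OG).

(** By conversion, [mult_epi] is [FG_ext] for the identity map. *)
Lemma mult_epiM A B : m (FG_mul A B) = mul (m A) (m B).
Proof. exact: (FG_extM hG id). Qed.

Lemma mult_epi_gen g : m (FG_gen g) = g.
Proof. exact: (FG_ext_gen hG id). Qed.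

(** [mult_epi] undoes the continuous map [FG_gen], so [tau] is coarser than [OG]. *)
Lemma tau_sub V : tau V -> OG V.
Proof.
move=> /(FM_gen tG); congr OG; apply/seteqP; split=> g /=; by rewrite mult_epi_gen.
Qed.

Lemma FM_translate a : rcont (FM_top OG) (FM_top OG) (fun b => FG_mul b a).
Proof.
have [tF mF _] := @FM_group_topology _ OG.
have h : rcont (FM_top OG) (prod_top (FM_top OG) (FM_top OG)) (fun b => (b, a)).
  by apply: rcont_pair => //; exact: rcont_cst.
exact: rcont_comp mF h.
Qed.

(** The saturation of [U] is the union of its translates by elements of the kernel, and translations
    are continuous. *)
Lemma mult_epi_open U : FM_top OG U -> tau (m @` U).
Proof.
have [tF _ _] := @FM_group_topology _ OG.
move=> OU; apply: (top_local tF) => A /= [B UB e].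
(* [C] lies in the kernel, and right translation by it takes [A] to the point [B] of [U]. *)
pose C := FG_mul (FG_inv A) B.
exists ((fun D => FG_mul D C) @^-1` U); split=> /=.
- exact: FM_translate.
- by rewrite /C (grp_mulA _ _ _ FG_is_group) (grp_mulVr FG_is_group) (grp_mul1l _ _ _ FG_is_group).
- move=> D /= UD; exists (FG_mul D C) => //.
  rewrite mult_epiM /C mult_epiM e (grp_homV FG_is_group hG m mult_epiM).
  by rewrite (grp_mulVl _ _ _ hG) (grp_mul1r hG).
Qed.

(** The square of a quotient map need not be a quotient map, but that of an open map is open; this
    lets the continuity of multiplication descend along [mult_epi]. *)
Lemma tau_group_topology : group_topology mul inv tau.
Proof.
have [tF mF vF] := @FM_group_topology _ OG.
have tT : is_topology tau by exact: quot_top_is_topology.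
split=> // V OV.
  apply/(prod_topP tT tT) => -[a b] /= Vab.
  have [|U [W [OU OW Ua Wb s]]] := (prod_topP tF tF _).1 (mF _ OV) (FG_gen a, FG_gen b).
    by rewrite /= mult_epiM !mult_epi_gen.
  exists (m @` U), (m @` W); split=> /=; [exact: mult_epi_open|exact: mult_epi_open|..].
  - by exists (FG_gen a) => //; rewrite mult_epi_gen.
  - by exists (FG_gen b) => //; rewrite mult_epi_gen.
  - by move=> [x y] [/= [A UA <-] [B WB <-]]; rewrite -mult_epiM; apply: (s (A, B)).
suff e : m @^-1` (inv @^-1` V) = FG_inv @^-1` (m @^-1` V) by rewrite /tau_top /quot_top /= e; exact: vF.
by apply/seteqP; split=> A /=; rewrite (grp_homV FG_is_group hG m mult_epiM).
Qed.
End tau.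

(** * Lifts of paths *)

Section continuity_at.
Context {Z : Type} {OZ : set (set Z)}.
Hypothesis hZ : is_topology OZ.

Definition cont_at {G : Type} (O : set (set G)) (phi : Z -> G) (z0 : Z) : Prop :=
  forall V, O V -> V (phi z0) -> exists U, [/\ OZ U, U z0 & forall z, U z -> V (phi z)].

Lemma cont_at_rcont {G : Type} (O : set (set G)) (phi : Z -> G) :
  (forall z0, cont_at O phi z0) -> rcont OZ O phi.
Proof.
move=> h V OV; apply: (top_local hZ) => z /(h z V OV)[U [OU Uz s]].
by exists U.
Qed.

Lemma cont_at_cst {G : Type} (O : set (set G)) (c : G) z0 : cont_at O (fun=> c) z0.
Proof. by move=> V _ Vc; exists setT; split=> //; case: hZ. Qed.

Lemma cont_at_near {G : Type} (O : set (set G)) (phi psi : Z -> G) z0 U :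
  OZ U -> U z0 -> (forall z, U z -> phi z = psi z) -> cont_at O phi z0 -> cont_at O psi z0.
Proof.
move=> OU Uz0 e h V OV; rewrite -e // => /(h V OV)[W [OW Wz0 s]].
exists (U `&` W); split=> //; first exact: top_setI.
by move=> z [Uz Wz]; rewrite -e //; apply: s.
Qed.

Context {G : Type} {mul : G -> G -> G} {inv : G -> G} {O : set (set G)}.
Hypothesis tO : group_topology mul inv O.

Lemma cont_at_mul (phi psi : Z -> G) z0 : cont_at O phi z0 -> cont_at O psi z0 ->
  cont_at O (fun z => mul (phi z) (psi z)) z0.
Proof.
case: tO => tT mT _ h1 h2 V OV /= Vz.
have [U [W [OU OW Uz Wz s]]] := (prod_topP tT tT _).1 (mT _ OV) (phi z0, psi z0) Vz.
have [U' [OU' U'z s1]] := h1 U OU Uz; have [W' [OW' W'z s2]] := h2 W OW Wz.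
exists (U' `&` W'); split=> //; first exact: top_setI.
by move=> z [/s1 a /s2 b]; apply: (s (phi z, psi z)).
Qed.

Lemma cont_at_inv (phi : Z -> G) z0 : cont_at O phi z0 -> cont_at O (fun z => inv (phi z)) z0.
Proof.
case: tO => _ _ vT h V OV /= Vz; exact: h (vT _ OV) Vz.
Qed.
End continuity_at.

Lemma path_nbhs {Y : Type} {OY : set (set Y)} (f : RR -> Y) (U : set Y) t :
  rcont (@open RR) OY f -> OY U -> U (f t) ->
  exists2 e : RR, 0 < e & forall s, t - e < s < t + e -> U (f s).
Proof. by move=> hf OU Ut; have /openRP := hf _ OU; apply. Qed.

Section lifts.
Context {Y : Type} {OY : set (set Y)} {UA UB : set Y}.
Hypotheses (oA : OY UA) (oB : OY UB) (cover : forall y, UA y \/ UB y).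
Context {G : Type} {mul : G -> G -> G} {inv : G -> G} {one : G}.
Hypothesis hG : is_group mul inv one.
Context {w : Y -> G}.
Notation path f := (rcont (@open RR) OY f).
Hypothesis w_const : forall f : RR -> Y, path f -> (forall r, UA (f r) /\ UB (f r)) ->
  w (f 0) = w (f 1).
Implicit Types (f : RR -> Y) (g : RR -> G).

Local Notation "x ** y" := (mul x y) (at level 40, left associativity).

(** [k] is the coordinate in the chart over [UA]; in the chart over [UB] the coordinate is [g]
    itself. The transition [w] multiplies on the right, so left multiplication preserves lifts. *)
Definition local_A f g (t e : RR) : Prop :=
  exists k, forall s, t - e < s < t + e -> UA (f s) /\ g s = k ** w (f s).

Definition local_B f g (t e : RR) : Prop :=
  exists k, forall s, t - e < s < t + e -> UB (f s) /\ g s = k.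

Definition local_lift f g (t : RR) : Prop :=
  exists2 e : RR, 0 < e & local_A f g t e \/ local_B f g t e.

(* [g] is a section of the pullback along [f] of the principal [G]-bundle over [Y] that is trivial
   over [UA] and over [UB] and has transition function [w]. *)
Definition is_lift f g : Prop := forall t, local_lift f g t.

Lemma w_const_itv f a b r s : path f ->
  (forall x, a < x < b -> UA (f x) /\ UB (f x)) -> a < r < b -> a < s < b -> w (f r) = w (f s).
Proof.
move=> hf h hr hs.
have := w_const (fun x => f (seg r s x)); rewrite seg0 seg1; apply.
  by apply: rcont_comp hf _; exact: rcont_seg.
by move=> x; apply: h; apply: seg_oo.
Qed.

(** The expression is the coordinate over [UA]. Where [g] is described in the other chart, [f]
    locally stays in the overlap, so [w] is constant along it. *)
Lemma lift_A f g a b s s' : path f -> is_lift f g ->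
  (forall r, a <= r <= b -> UA (f r)) -> a <= s <= b -> a <= s' <= b ->
  g s ** inv (w (f s)) = g s' ** inv (w (f s')).
Proof.
move=> hf hg hA hs hs'.
pose c := seg s s'; have hc : rcont (@open RR) (@open RR) c by exact: rcont_seg.
have hAc x : UA (f (c x)) by apply: hA; apply: seg_cc.
suff h : forall x y, g (c x) ** inv (w (f (c x))) = g (c y) ** inv (w (f (c y))).
  by have := h 0 1; rewrite /c seg0 seg1.
apply: (locally_constant (fun x => g (c x) ** inv (w (f (c x))))) => x.
have [e e0 he] := hg (c x).
have [|d d0 hd] := path_nbhs c _ x hc (open_itv_oo (c x - e) (c x + e)); first by rewrite /=; lra.
have hx : x - d < x < x + d by lra.
exists d => // y hy; case: he => -[k hk].
  by rewrite (hk (c y) (hd _ hy)).2 (hk (c x) (hd _ hx)).2 !(grp_mulK hG).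
rewrite (hk (c y) (hd _ hy)).2 (hk (c x) (hd _ hx)).2; congr (_ ** inv _).
apply: (w_const_itv (fun y => f (c y)) (x - d) (x + d)) => //.
  exact: rcont_comp hf hc.
by move=> z /hd /hk[].
Qed.

Lemma lift_B f g a b s s' : path f -> is_lift f g ->
  (forall r, a <= r <= b -> UB (f r)) -> a <= s <= b -> a <= s' <= b -> g s = g s'.
Proof.
move=> hf hg hB hs hs'.
pose c := seg s s'; have hc : rcont (@open RR) (@open RR) c by exact: rcont_seg.
have hBc x : UB (f (c x)) by apply: hB; apply: seg_cc.
suff h : forall x y, g (c x) = g (c y) by have := h 0 1; rewrite /c seg0 seg1.
apply: (locally_constant (fun x => g (c x))) => x.
have [e e0 he] := hg (c x).
have [|d d0 hd] := path_nbhs c _ x hc (open_itv_oo (c x - e) (c x + e)); first by rewrite /=; lra.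
have hx : x - d < x < x + d by lra.
exists d => // y hy; case: he => -[k hk].
  rewrite (hk (c y) (hd _ hy)).2 (hk (c x) (hd _ hx)).2; congr (_ ** _).
  apply: (w_const_itv (fun y => f (c y)) (x - d) (x + d)) => //.
    exact: rcont_comp hf hc.
  by move=> z /hd /hk[].
by rewrite (hk (c y) (hd _ hy)).2 (hk (c x) (hd _ hx)).2.
Qed.

(** Agreement propagates locally: two lifts in the same chart have equal coordinates, and if the
    charts differ then [f] is in the overlap, where [w] is constant along it. *)
Lemma lift_uniq f g g' t0 : path f -> is_lift f g -> is_lift f g' -> g t0 = g' t0 ->
  forall t, g t = g' t.
Proof.
move=> hf hg hg'; apply: local_induction => t.
have [e e0 he] := hg t; have [e' e0' he'] := hg' t.
have [d d0 [de de']] := small_pos _ _ e0 e0'; exists d => //.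
have min_l x : t - d < x < t + d -> t - e < x < t + e by lra.
have min_r x : t - d < x < t + d -> t - e' < x < t + e' by lra.
have wE : (forall x, t - d < x < t + d -> UA (f x) /\ UB (f x)) -> forall r s,
    t - d < r < t + d -> t - d < s < t + d -> w (f r) = w (f s).
  by move=> h r s; apply: w_const_itv.
move=> r s hr hs.
case: he => -[k hk]; case: he' => -[k' hk'];
  rewrite (hk r (min_l _ hr)).2 (hk s (min_l _ hs)).2 (hk' r (min_r _ hr)).2 (hk' s (min_r _ hs)).2.
- by move=> /(grp_mulI hG) ->.
- rewrite (wE _ r s hr hs) // => x hx.
  by split; [case: (hk x (min_l _ hx))|case: (hk' x (min_r _ hx))].
- rewrite (wE _ r s hr hs) // => x hx.
  by split; [case: (hk' x (min_r _ hx))|case: (hk x (min_l _ hx))].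
- by [].
Qed.

Lemma lift_mul f g c : is_lift f g -> is_lift f (fun t => c ** g t).
Proof.
move=> h t; have [e e0 he] := h t; exists e => //.
case: he => -[k hk]; [left|right]; exists (c ** k) => s /hk[? ->]; split=> //.
by rewrite (grp_mulA _ _ _ hG).
Qed.

Lemma local_lift_clampR f g : (forall t, 0 <= t <= 1 -> local_lift f g t) ->
  is_lift (fun r => f (clampR r)) (fun r => g (clampR r)).
Proof.
move=> h t; have [e e0 he] := h _ (clampR_itv t); exists e => //.
by case: he => -[k hk]; [left|right]; exists k => s /(clampR_near _ _ _ e0) /hk.
Qed.

(** The values of [g] beyond [r] are discarded and replaced by those with constant coordinate in a
    chart that contains [f] on the whole interval from [a] to [b]. *)
Lemma lift_extend f g r s a b : path f -> (forall t, t <= r -> local_lift f g t) ->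
  a < r < b -> r <= s < b ->
  (forall x, a < x < b -> UA (f x)) \/ (forall x, a < x < b -> UB (f x)) ->
  exists g', forall t, t <= s -> local_lift f g' t.
Proof.
move=> hf hg hr hs hAB.
pose ext x := match pselect (forall x, a < x < b -> UA (f x)) with
  | left _ => g r ** inv (w (f r)) ** w (f x) | right _ => g r end.
exists (fun x => if x <= r then g x else ext x) => t ts.
have extr : ext r = g r by rewrite /ext; case: pselect => // _; rewrite (grp_mulVK hG).
have [tr|tr|tr] := ltgtP t r.
- have [e e0 he] := hg t (ltW tr).
  have [|d d0 [d1 d2]] := small_pos e (r - t) e0; first lra.
  exists d => //; have aux x : t - d < x < t + d -> t - e < x < t + e /\ x <= r.
    by split; lra.
  by case: he => -[k hk]; [left|right]; exists k => x /aux[/hk ? ->].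
- have [||d d0 [d1 d2]] := small_pos (t - r) (b - t); [lra|lra|].
  exists d => //; have aux x : t - d < x < t + d -> a < x < b /\ (x <= r) = false.
    by split; try apply/negbTE; lra.
  rewrite /local_A /local_B /ext; case: pselect => hA.
    left; exists (g r ** inv (w (f r))) => x /aux[hx ->]; split=> //; exact: hA.
  right; exists (g r) => x /aux[hx ->]; split=> //.
  by case: hAB => // hB; apply: hB.
(* The seam: the chart describing [g] near [r] may differ from the one used for the extension, and
   then [w] is constant along [f] near [r]. *)
- subst t; have [e e0 he] := hg r (lexx _).
  have [||d' d0' [d1 d2]] := small_pos (r - a) (b - r); [lra|lra|].
  have [d d0 [d3 d4]] := small_pos _ _ e0 d0'.
  have aux x : r - d < x < r + d -> r - e < x < r + e /\ a < x < b by split; lra.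
  have hrd : r - d < r < r + d by lra.
  exists d => //.
  have [hA|hA] := pselect (forall x, a < x < b -> UA (f x)).
    left; exists (g r ** inv (w (f r))) => x hx; split; first by apply: hA; case: (aux _ hx).
    have -> : ext x = g r ** inv (w (f r)) ** w (f x) by rewrite /ext; case: pselect.
    case: leP => // xr; case: he => -[k hk].
      by rewrite (hk x (aux _ hx).1).2 (hk r (aux _ hrd).1).2 (grp_mulK hG).
    rewrite (hk x (aux _ hx).1).2 (hk r (aux _ hrd).1).2.
    rewrite (w_const_itv f (r - d) (r + d) r x) // ?(grp_mulVK hG) // => y /aux[/hk[? _] /hA ?].
    by [].
  have hB : forall x, a < x < b -> UB (f x) by case: hAB.
  right; exists (g r) => x hx; split; first by apply: hB; case: (aux _ hx).
  have -> : ext x = g r by rewrite /ext; case: pselect.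
  case: leP => // xr; case: he => -[k hk]; last first.
    by rewrite (hk x (aux _ hx).1).2 (hk r (aux _ hrd).1).2.
  rewrite (hk x (aux _ hx).1).2 (hk r (aux _ hrd).1).2; congr (_ ** _).
  by apply: (w_const_itv f (r - d) (r + d) x r) => // y /aux[/hk[? _] /hB ?].
Qed.

(** Induction on how far to the right a lift is defined. Clamping makes the path constant, with
    value in [UB], on the negative half-line, where the constant [one] starts the induction. *)
Lemma lift_exists f : path f -> UB (f 0) ->
  exists2 g, is_lift (fun r => f (clampR r)) g & g 0 = one.
Proof.
move=> hf hB; pose f' r := f (clampR r).
have hf' : path f' by apply: rcont_comp hf _; rcont_real.
suff [g hg] : exists g, forall t, t <= 1 -> local_lift f' g t.
  (* [g] is a lift only up to 1, hence the clamp; the left factor normalizes the value at 0. *)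
  exists (fun t => inv (g (clampR 0)) ** g (clampR t)); last by rewrite (grp_mulVl _ _ _ hG).
  apply: (lift_mul (fun r => f (clampR r)) (fun t => g (clampR t))).
  have -> : (fun r => f (clampR r)) = fun r => f' (clampR r).
    by apply/funext => r; rewrite /f' clampR_clampR.
  by apply: local_lift_clampR => t /andP[_]; apply: hg.
apply: (@local_induction (fun s => exists g, forall t, t <= s -> local_lift f' g t) 0) => [t|].
  have [U [hU OU Ut]] : exists U, [/\ U = UA \/ U = UB, OY U & U (f' t)].
    by case: (cover (f' t)) => h; [exists UA|exists UB]; split=> //; [left|right].
  have [e e0 he] := path_nbhs _ _ _ hf' OU Ut.
  exists e => // r s hr hs [g hg].
  have [sr|rs] := leP s r; first by exists g => x xs; apply: hg; exact: le_trans sr.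
  apply: (lift_extend f' g r s (t - e) (t + e)) => //; first by lra.
  by case: hU => eU; subst U; [left|right].
exists (fun=> one) => t t0.
have [|e e0 he] := path_nbhs _ _ t hf' oB; first by rewrite /f' clampR_le0.
by exists e => //; right; exists one => s /he.
Qed.

(** At the junction both paths are in [UB], where lifts are constant, so both formulas take the
    value [g 1] near 1/2. *)
Lemma lift_concat f f' g g' : path f -> path f' -> is_lift f g -> is_lift f' g' ->
  f 1 = f' 0 -> UB (f 1) -> g' 0 = one ->
  is_lift (concat f f') (fun t => if t <= 1/2 then g (2 * t) else g 1 ** g' (2 * t - 1)).
Proof.
move=> hf hf' hg hg' eff hB g'0 t.
have [th|th|th] := ltgtP t (1/2).
- have [e e0 he] := hg (2 * t); have [||d d0 [d1 d2]] := small_pos (e / 2) (1/2 - t); [lra|lra|].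
  exists d => //; have aux s : t - d < s < t + d ->
      s <= 1/2 /\ (2 * t - e < 2 * s < 2 * t + e) by split; lra.
  by case: he => -[k hk]; [left|right]; exists k => s /aux[h /hk]; rewrite /concat h.
- have [e e0 he] := lift_mul _ _ (g 1) hg' (2 * t - 1).
  have [||d d0 [d1 d2]] := small_pos (e / 2) (t - 1/2); [lra|lra|].
  exists d => //; have aux s : t - d < s < t + d ->
      (s <= 1/2) = false /\ (2 * t - 1 - e < 2 * s - 1 < 2 * t - 1 + e).
    by split; try apply/negbTE; lra.
  by case: he => -[k hk]; [left|right]; exists k => s /aux[h /hk]; rewrite /concat h.
have [e e0 he] := path_nbhs _ _ 1 hf oB hB.
have [|e' e0' he'] := path_nbhs _ _ 0 hf' oB; first by rewrite -eff.
have [||d d0 [d1 d2]] := small_pos (e / 2) (e' / 2); [lra|lra|].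
exists d => //; right; exists (g 1) => s; rewrite th => hs.
have [h1 h2] : (1 - e < 2 * s < 1 + e) /\ (0 - e' < 2 * s - 1 < 0 + e') by split; lra.
rewrite /concat; case: leP => sh; split.
- exact: he.
- by apply: (lift_B f g (2 * s) 1) => //; [move=> r ?; apply: he; lra|lra|lra].
- exact: he'.
- rewrite -[RHS](grp_mul1r hG) -g'0; congr (_ ** _).
  by apply: (lift_B f' g' 0 (2 * s - 1)) => //; [move=> r ?; apply: he'; lra|lra|lra].
Qed.

(** * Lifts depending on a parameter *)

Section parameters.
Context {Z : Type} {OZ : set (set Z)} {O : set (set G)}.
Hypotheses (hZ : is_topology OZ) (tO : group_topology mul inv O).
Context (F : Z -> RR -> Y) (g : Z -> RR -> G) (z0 : Z).
Hypotheses (hF : forall z, path (F z)) (hg : forall z, is_lift (F z) (g z))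
  (g0 : forall z, g z 0 = one) (F0 : ~ UA (F z0 0)) (F1 : ~ UA (F z0 1)).
Hypothesis F_near : forall U s s', OY U -> (forall r, s <= r <= s' -> U (F z0 r)) ->
  exists V, [/\ OZ V, V z0 & forall z, V z -> forall r, s <= r <= s' -> U (F z r)].
Hypothesis w_near : forall s, UA (F z0 s) -> UB (F z0 s) ->
  cont_at (OZ := OZ) O (fun z => w (F z s)) z0.

(** Continuity at [z0] is carried along the path by chart coordinates. Inside one chart the
    coordinate does not depend on [s], and [F_near] makes this hold for all [z] close to [z0] at
    once; a change of chart costs a factor [w (F z s)], continuous by [w_near]. *)
Lemma lift_cont_at : cont_at (OZ := OZ) O (fun z => g z 1) z0.
Proof.
pose cA s := cont_at (OZ := OZ) O (fun z => g z s ** inv (w (F z s))) z0.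
pose cB s := cont_at (OZ := OZ) O (fun z => g z s) z0.
(* The ends of the path for [z0] lie outside [UA]: at 0 only the coordinate over [UB] counts, and it
   is constantly [one]; at 1 it is the wanted quantity. *)
suff /(_ 1)[_ h] : forall s, (UA (F z0 s) -> cA s) /\ (UB (F z0 s) -> cB s).
  by apply: h; case: (cover (F z0 1)).
apply: (@local_induction (fun s => (UA (F z0 s) -> cA s) /\ (UB (F z0 s) -> cB s)) 0); last first.
  split=> // _; rewrite /cB (_ : (fun z => _) = fun=> one); first exact: cont_at_cst.
  by apply/funext.
move=> t; have [h|h] := cover (F z0 t).
  have [e e0 he] := path_nbhs _ _ _ (hF z0) oA h.
  have [r hr|V [OV Vz0 hV]] := F_near UA (t - e / 2) (t + e / 2) oA; first by apply: he; lra.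
  exists (e / 2); first lra.
  move=> r s hr hs [+ _]; have Ar : UA (F z0 r) by apply: he; lra.
  move=> /(_ Ar) hAr.
  have hAs : cA s.
    apply: (cont_at_near hZ O _ _ z0 V OV Vz0 _ hAr) => z /hV hz.
    by apply: (lift_A (F z) (g z) (t - e / 2) (t + e / 2)) => //; lra.
  split=> // Bs; have As : UA (F z0 s) by apply: he; lra.
  rewrite /cB (_ : (fun z => g z s) = fun z => g z s ** inv (w (F z s)) ** w (F z s)).
    by apply: (cont_at_mul hZ tO) => //; exact: w_near.
  by apply/funext => z; rewrite (grp_mulVK hG).
have [e e0 he] := path_nbhs _ _ _ (hF z0) oB h.
have [r hr|V [OV Vz0 hV]] := F_near UB (t - e / 2) (t + e / 2) oB; first by apply: he; lra.
exists (e / 2); first lra.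
move=> r s hr hs [_ +]; have Br : UB (F z0 r) by apply: he; lra.
move=> /(_ Br) hBr.
have hBs : cB s.
  apply: (cont_at_near hZ O _ _ z0 V OV Vz0 _ hBr) => z /hV hz.
  by apply: (lift_B (F z) (g z) (t - e / 2) (t + e / 2)) => //; lra.
split=> // As; have Bs : UB (F z0 s) by apply: he; lra.
by apply: (cont_at_mul hZ tO) => //; apply: (cont_at_inv tO); exact: w_near.
Qed.
End parameters.
End lifts.

(** * The suspension *)

Section suspension.
Context {X : topologicalType}.
Local Notation S := (susp X).
Local Notation OS := (susp_top X).
Local Notation base := (@susp_pt X).
Local Notation path f := (rcont (@open RR) OS f).

Lemma plus_top_is_topology : is_topology (plus_top X).
Proof.
split; first exact: openT.
- by move=> U V hU hV; apply: openI.
- by move=> F hF; rewrite /plus_top /= preimage_bigcup; apply: bigcup_open => U /hF.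
Qed.

Lemma susp_top_is_topology : is_topology OS.
Proof. by apply: quot_top_is_topology; exact: prod_top_is_topology. Qed.

Lemma susp_q_eq (p q : option X * I) : susp_q p = susp_q q <-> susp_rel p q.
Proof.
split; first by apply: qcls_inj => x; left.
apply: qcls_eq => [x y [->|[? ?]]|x y z [->|[? ?]] // [<-|[? ?]]]; by [left|right].
Qed.

Lemma susp_q_surj (p : S) : exists o t, p = susp_q (o, t).
Proof.
exists (qrep p).1, (qrep p).2; rewrite -surjective_pairing.
by rewrite /susp_q qrepK.
Qed.

Lemma susp_q_base p : susp_base p -> susp_q p = base.
Proof. by move=> h; apply/susp_q_eq; right; split=> //; left. Qed.

Definition wr (x : X) (r : RR) : S := wedge_pt x (clamp r).

Lemma wr_le0 x r : r <= 0 -> wr x r = base.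
Proof. by move=> h; apply: susp_q_base; right; left => /=; rewrite clamp_le0. Qed.

Lemma wr_ge1 x r : 1 <= r -> wr x r = base.
Proof. by move=> h; apply: susp_q_base; right; right => /=; rewrite clamp_ge1. Qed.

Lemma wr_clampR x r : wr x (clampR r) = wr x r.
Proof. by rewrite /wr clamp_clampR. Qed.

Lemma susp_q_inner o t x r : 0 < r < 1 -> susp_q (o, t) = wr x r -> o = Some x /\ proj1_sig t = r.
Proof.
move=> hr /susp_q_eq[[-> ->]|[_]].
  by split; rewrite //= clampR_id //; lra.
case=> /= [//|[]] /(congr1 (@proj1_sig _ _)) /=; rewrite clampR_id; lra.
Qed.

Lemma wr_inj x r x' r' : 0 < r < 1 -> 0 < r' < 1 -> wr x r = wr x' r' -> x = x' /\ r = r'.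
Proof.
move=> hr hr' /(susp_q_inner _ _ _ _ hr')[[->]] /=.
by rewrite clampR_id //; lra.
Qed.

Definition cyl (U : set X) (J : set RR) : set S :=
  [set p | exists x r, [/\ U x, J r & p = wr x r]].

Lemma cyl_wr U (J : set RR) x r : (forall r, J r -> 0 < r < 1) -> 0 < r < 1 ->
  cyl U J (wr x r) <-> U x /\ J r.
Proof.
move=> hJ hr; split=> [[x' [r' [Ux Jr /(wr_inj _ _ _ _ hr (hJ _ Jr))[-> ->]]]]//|[Ux Jr]].
by exists x, r.
Qed.

Lemma preimage_cyl U (J : set RR) : (forall r, J r -> 0 < r < 1) ->
  susp_q @^-1` cyl U J = [set o | exists2 x, o = Some x & U x] `*` (@proj1_sig _ _ @^-1` J).
Proof.
move=> hJ; apply/seteqP; split=> -[o t] /=.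
  by move=> [x [r [Ux Jr /(susp_q_inner _ _ _ _ (hJ _ Jr))[-> e]]]]; rewrite /= e; split=> //; exists x.
move=> [/= [x -> Ux] Jt]; exists x, (proj1_sig t); split=> //.
by rewrite /wr clampK.
Qed.

Lemma open_cyl U (J : set RR) : open U -> open J -> (forall r, J r -> 0 < r < 1) -> OS (cyl U J).
Proof.
move=> OU OJ hJ; rewrite /susp_top /quot_top /= preimage_cyl //; apply: prod_topX.
  rewrite /plus_top /= (_ : _ @^-1` _ = U) //.
  by apply/seteqP; split=> x /= => [[y [->]]//|Ux]; exists x.
exact: rcont_val.
Qed.

Definition UA : set S := cyl setT [set r : RR | 0 < r < 1].
Definition UB : set S := ~` cyl setT [set r : RR | 1/3 <= r <= 2/3].

Lemma open_UA : OS UA.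
Proof. by apply: open_cyl => //; [exact: openT|exact: open_itv_oo]. Qed.

Lemma open_UB : OS UB.
Proof.
have hP : is_topology (prod_top (plus_top X) I_top) by exact: prod_top_is_topology.
have hJ (r : RR) : 1/3 <= r <= 2/3 -> 0 < r < 1 by lra.
have e : susp_q @^-1` UB = (fst @^-1` [set None]) `|`
   (snd @^-1` (@proj1_sig _ _ @^-1` ([set r : RR | r < 1/3] `|` [set r | 2/3 < r]))).
  have -> : susp_q @^-1` UB = ~` (susp_q @^-1` cyl setT [set r : RR | 1/3 <= r <= 2/3]) by [].
  rewrite preimage_cyl //; apply/seteqP; split=> -[[x|] [t ht]] /=.
  - move=> h; right; apply: contrapT => h'; apply: h; split; first by exists x.
    apply/andP; split; rewrite leNgt; apply/negP => ?; apply: h'; [by left|by right].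
  - by left.
  - by move=> [//|[h|h]] [_ /=]; lra.
  - by move=> _ [[]].
suff : prod_top (plus_top X) I_top (susp_q @^-1` UB) by [].
rewrite e; have hI := I_top_is_topology; have hX := plus_top_is_topology.
apply: (top_setU _ _ hP).
  apply: (rcont_fst hI); rewrite /plus_top /= (_ : _ @^-1` _ = set0); first exact: open0.
  by apply/seteqP; split.
apply: (rcont_snd hX); apply: rcont_val.
by apply: openU; [exact: open_ltR|exact: open_gtR].
Qed.

Lemma base_notin_UA : ~ UA base.
Proof.
move=> [x [r [_ hr /(susp_q_inner _ _ _ _ hr)[]]]] //.
Qed.

Lemma susp_cases (p : S) : p = base \/ exists x r, 0 < r < 1 /\ p = wr x r.
Proof.
have [o [t ->]] := susp_q_surj p.
have [h|h] := pselect (susp_base (o, t)); first by left; exact: susp_q_base.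
right; case: o h => [x|] h; last by case: h; left.
exists x, (proj1_sig t); rewrite /wr clampK; split=> //.
case: t h => t ht h; have /andP[t0 t1] := ht; rewrite /= !lt_neqAle t0 t1 !andbT.
by apply/andP; split; apply/eqP => e; apply: h; right; [left|right]; apply: I_eq.
Qed.

Lemma UA_wr x r : 0 < r < 1 -> UA (wr x r).
Proof. by move=> hr; exists x, r. Qed.

Lemma UB_base : UB base.
Proof.
move=> [x [r [_ /= hr]]] e; apply: base_notin_UA; rewrite e; apply: UA_wr; lra.
Qed.

Lemma UB_wr x r : 0 < r < 1 -> UB (wr x r) <-> r < 1/3 \/ 2/3 < r.
Proof.
move=> hr; rewrite /UB /= cyl_wr; [|move=> ? /=; lra|done].
split=> [h|[h|h] [_ /=]]; [|lra|lra].
have [?|?] := ltP r (1/3); first by left.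
have [?|?] := ltP (2/3) r; first by right.
by case: h; split=> //; apply/andP.
Qed.

Lemma susp_cover (p : S) : UA p \/ UB p.
Proof.
have [->|[x [r [hr ->]]]] := susp_cases p; first by right; exact: UB_base.
by left; exact: UA_wr.
Qed.

Lemma rcont_wr {T : Type} {OT : set (set T)} (x : T -> X) (r : T -> RR) : is_topology OT ->
  rcont OT open x -> rcont OT open r -> rcont OT OS (fun t => wr (x t) (r t)).
Proof.
move=> hT hx hr.
have hq : rcont (prod_top (plus_top X) I_top) OS susp_q by [].
apply: (rcont_comp susp_q) hq _; apply: rcont_pair => //.
- by move=> V /hx.
- exact: rcont_clamp.
Qed.

Lemma path_wr x : path (wr x).
Proof.
have hR := open_is_topology RR.
by apply: (rcont_wr (fun=> x) id) => //; exact: rcont_cst.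
Qed.

(** Over [UA] the suspension is the product of [X] with the open unit interval. By [wr_inj] the
    pointwise choice of coordinates is forced, and it is continuous because cylinders are open. *)
Lemma susp_coords {T : Type} {OT : set (set T)} (f : T -> S) : is_topology OT ->
  rcont OT OS f -> (forall t, UA (f t)) ->
  exists (x : T -> X) (r : T -> RR), [/\ rcont OT open x, rcont OT open r &
    forall t, 0 < r t < 1 /\ f t = wr (x t) (r t)].
Proof.
move=> hT hf hA.
have /choice[xr hxr] : forall t, exists xr : X * RR, 0 < xr.2 < 1 /\ f t = wr xr.1 xr.2.
  by move=> t; have [x [r [_ hr ->]]] := hA t; exists (x, r).
exists (fun t => (xr t).1), (fun t => (xr t).2); split=> // V OV.
  have := hf _ (open_cyl V _ OV (open_itv_oo 0 1) (fun r h => h)).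
  congr OT; apply/seteqP; split=> t /=; have [h ->] := hxr t; rewrite cyl_wr //.
  by case.
have OV' : open (V `&` [set r : RR | 0 < r < 1]) by apply: openI => //; exact: open_itv_oo.
have := hf _ (open_cyl setT _ openT OV' (fun r h => h.2)).
congr OT; apply/seteqP; split=> t /=; have [h ->] := hxr t; rewrite cyl_wr //; try by move=> ? [].
by case=> _ [].
Qed.

Lemma rloop_wr x : rloop (OY := OS) (y0 := base) (wr x).
Proof. by split; [exact: path_wr|rewrite wr_le0|rewrite wr_ge1]. Qed.

Lemma pcls_wr_path_conn x y : path_conn open x y ->
  pcls (OY := OS) (y0 := base) (wr x) = pcls (wr y).
Proof.
case=> p [hp p0 p1]; apply: pcls_phtpy; [exact: rloop_wr|exact: rloop_wr|].
exists (fun z => wr (p (clamp z.2)) z.1); split=> [|s|s|t|t] /=.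
- apply: rcont_wr; first exact: rr_top_is_topology.
    by apply: rcont_comp hp _; rcont_real.
  exact: rr_fst.
- by rewrite clamp_le0 // p0.
- by rewrite clamp_ge1 // p1.
- by rewrite !wr_le0.
- by rewrite !wr_ge1.
Qed.

(** * The transition function *)

Section transition.
Context {G : Type} {one : G} {gen : X -> G}.

(** Chosen so that a lift along the ray of [x] gains exactly [gen x]: coming from the lower part of
    [UB] through [UA] it reaches the upper part, where the charts differ by that factor. *)
Definition trans (p : S) : G :=
  match pselect (exists x, exists2 r, 1/2 < r < 1 & p = wr x r) with
  | left h => gen (proj1_sig (cid h))
  | right _ => one
  end.

Lemma trans_up x r : 1/2 < r < 1 -> trans (wr x r) = gen x.
Proof.
move=> hr; rewrite /trans; case: pselect => [h|[]]; last by exists x; exists r.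
case: cid => y /= [s hs e]; congr gen.
have [hr' hs'] : 0 < r < 1 /\ 0 < s < 1 by split; lra.
by have [->] := wr_inj _ _ _ _ hr' hs' e.
Qed.

Lemma trans_down x r : r <= 1/2 -> trans (wr x r) = one.
Proof.
move=> hr; rewrite /trans; case: pselect => // -[y [s hs e]].
have [h|h] := leP r 0.
  by case: base_notin_UA; rewrite -(wr_le0 x r h) e; apply: UA_wr; lra.
have [hr' hs'] : 0 < r < 1 /\ 0 < s < 1 by split; lra.
by have [_ ers] := wr_inj _ _ _ _ hr' hs' e; exfalso; lra.
Qed.

Lemma trans_base : trans base = one.
Proof.
rewrite /trans; case: pselect => // -[y [s hs e]].
by case: base_notin_UA; rewrite e; apply: UA_wr; lra.
Qed.

Hypothesis gen_path : forall x y, path_conn open x y -> gen x = gen y.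

(** In the overlap the height avoids the middle third, so it stays on one side of 1/2, and the
    [X]-coordinate is itself a path in [X]. *)
Lemma trans_const (f : RR -> S) : path f -> (forall r, UA (f r) /\ UB (f r)) ->
  trans (f 0) = trans (f 1).
Proof.
move=> hf hAB; have hR := open_is_topology RR.
have [x [r [hx hr hxr]]] := susp_coords f hR hf (fun t => (hAB t).1).
have hr' t : r t < 1/3 \/ 2/3 < r t.
  by have [h e] := hxr t; have [_] := hAB t; rewrite e UB_wr.
have side : (1/2 < r 0) = (1/2 < r 1).
  apply: (locally_constant (fun t => 1/2 < r t)) => t; case: (hr' t) => ht.
    have [e e0 he] := path_nbhs r _ t hr (open_ltR (1/3)) ht.
    exists e => // s /he /= hs; apply/idP/idP; lra.
  have [e e0 he] := path_nbhs r _ t hr (open_gtR (2/3)) ht.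
  exists e => // s /he /= hs; apply/idP/idP; lra.
have [h0 ->] := hxr 0; have [h1 ->] := hxr 1.
have gx : gen (x 0) = gen (x 1).
  by apply: gen_path; exists (fun t => x (proj1_sig t)); split=> //; apply: rcont_comp hx rcont_val.
have [h|h] := ltP (1/2) (r 0).
  by rewrite !trans_up -?side //; apply/andP; split; move: h h0 h1 => ? ? ?; lra.
by rewrite !trans_down //; move: side h; case: ltP => //; lra.
Qed.
End transition.

(** * Contracting the outer thirds *)

Section collapse.

(** Sends the lower third to 0 and the upper third to 1, and stretches the middle third over the
    unit interval. *)
Definition psi (r : RR) : RR := clampR (3 * r - 1).

(* Pushes the complement of the middle third of the suspension onto the base point. *)
Definition collapse (z : S * RR) : S :=
  susp_q ((qrep z.1).1, clamp ((1 - z.2) * proj1_sig (qrep z.1).2 + z.2 * psi (proj1_sig (qrep z.1).2))).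

(** Independence of the representative: representatives of the base point lie over [None] or at
    height 0 or 1, and every stage keeps them there. *)
Lemma collapseE o t tau :
  collapse (susp_q (o, t), tau) =
  susp_q (o, clamp ((1 - tau) * proj1_sig t + tau * psi (proj1_sig t))).
Proof.
rewrite /collapse /=.
have /susp_q_eq[->//|[h1 h2]] : susp_q (qrep (susp_q (o, t))) = susp_q (o, t) by exact: qrepK.
have aux (q : option X * I) : susp_base q ->
    susp_base (q.1, clamp ((1 - tau) * proj1_sig q.2 + tau * psi (proj1_sig q.2))).
  case=> [h|[h|h]]; first by left.
    by right; left => /=; rewrite h /psi /= clampR_le0 ?clamp_le0 //; lra.
  by right; right => /=; rewrite h /psi /= clampR_ge1 ?clamp_ge1 //; lra.
by rewrite (susp_q_base _ (aux _ h1)) (susp_q_base _ (aux (o, t) h2)).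
Qed.

Lemma rcont_collapse : rcont (prod_top OS open) OS collapse.
Proof.
have hI := I_top_is_topology; have hX := plus_top_is_topology; have hR := open_is_topology RR.
have hP : is_topology (prod_top (plus_top X) I_top) by exact: prod_top_is_topology.
have hPP : is_topology (prod_top (prod_top (plus_top X) I_top) (@open RR)) by exact: prod_top_is_topology.
apply: whitehead => //; first by move=> p; have [o [t ->]] := susp_q_surj p; exists (o, t).
rewrite (_ : (fun p => _) = fun p : (option X * I) * RR =>
  susp_q (p.1.1, clamp ((1 - p.2) * proj1_sig p.1.2 + p.2 * psi (proj1_sig p.1.2)))); last first.
  by apply/funext => -[[o t] tau]; rewrite collapseE.
have hq : rcont (prod_top (plus_top X) I_top) OS susp_q by [].
have h1 : rcont (prod_top (prod_top (plus_top X) I_top) (@open RR)) (prod_top (plus_top X) I_top) fst.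
  exact: rcont_fst.
have h2 : rcont (prod_top (prod_top (plus_top X) I_top) (@open RR)) (@open RR) snd.
  exact: rcont_snd.
have h3 : rcont (prod_top (prod_top (plus_top X) I_top) (@open RR)) (@open RR)
    (fun p => proj1_sig p.1.2).
  apply: (rcont_comp (@proj1_sig _ _) (fun p => p.1.2)) rcont_val _.
  by apply: (rcont_comp snd fst) h1; exact: rcont_snd.
apply: (rcont_comp susp_q) hq _; apply: rcont_pair => //.
  by apply: (rcont_comp fst fst) h1; exact: rcont_fst.
by rewrite /psi; rcont_real.
Qed.

Lemma collapse_wr x r tau : 0 <= r <= 1 ->
  collapse (wr x r, tau) = wr x ((1 - tau) * r + tau * psi r).
Proof. by move=> hr; rewrite /wr /wedge_pt collapseE /= clampR_id. Qed.

Lemma collapse_base tau : collapse (base, tau) = base.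
Proof. by rewrite collapseE; apply: susp_q_base; left. Qed.

Lemma collapse0 p : collapse (p, 0) = p.
Proof.
have [->|[x [r [hr ->]]]] := susp_cases p; first exact: collapse_base.
by rewrite collapse_wr; [congr wr; lra|lra].
Qed.

Lemma collapse1 p : UB p -> collapse (p, 1) = base.
Proof.
have [->|[x [r [hr ->]]]] := susp_cases p; first by rewrite collapse_base.
rewrite UB_wr // => h; rewrite collapse_wr; last lra.
case: h => h; rewrite /psi.
  by rewrite (clampR_le0 (3 * r - 1)) ?wr_le0 //; lra.
by rewrite (clampR_ge1 (3 * r - 1)) ?wr_ge1 //; lra.
Qed.
End collapse.
End suspension.

(** * Monodromy *)

Section susp_homotopy.
Context {X : topologicalType}.
Local Notation S := (susp X).
Local Notation OS := (susp_top X).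
Local Notation base := (@susp_pt X).
Local Notation path f := (rcont (@open RR) OS f).
Local Notation UA := (@UA X).
Local Notation UB := (@UB X).
Local Notation lp := (rloop (OY := OS) (y0 := base)).
Local Notation pi1S := (pi1 OS base).
Local Notation cls := (pcls (OY := OS) (y0 := base)).

Lemma loop_ext (a b : loop OS base) : (forall t, proj1_sig a t = proj1_sig b t) -> a = b.
Proof. by case: a b => [a ha] [b hb] /= e; apply: eq_exist; apply/funext. Qed.

Lemma loopR_clampR (a : loop OS base) : (fun r => loopR a (clampR r)) = loopR a.
Proof. by apply/funext => r; rewrite /loopR clamp_clampR. Qed.

Lemma loopR_le0 (a : loop OS base) r : r <= 0 -> loopR a r = base.
Proof. by move=> h; rewrite /loopR clamp_le0 //; case: (proj2_sig a). Qed.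

Lemma loopR_ge1 (a : loop OS base) r : 1 <= r -> loopR a r = base.
Proof. by move=> h; rewrite /loopR clamp_ge1 //; case: (proj2_sig a). Qed.

Section monodromy.
Context {G : Type} {mul : G -> G -> G} {inv : G -> G} {one : G}.
Hypothesis hG : is_group mul inv one.
Context {gen : X -> G}.
Hypothesis gen_path : forall x y, path_conn open x y -> gen x = gen y.
Local Notation w := (trans (one := one) (gen := gen)).
Local Notation lift := (is_lift (UA := UA) (UB := UB) (mul := mul) (w := w)).

Local Notation wc := (@trans_const X G one gen gen_path).

Lemma loop_lift_exists (a : loop OS base) : exists2 g, lift (loopR a) g & g 0 = one.
Proof.
have [ha a0 _] := rloop_loopR a; have hB : UB (loopR a 0) by rewrite a0; exact: UB_base.
have [g hg g0] := lift_exists open_UA open_UB susp_cover hG wc (loopR a) ha hB.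
by exists g => //; rewrite -loopR_clampR.
Qed.

Definition loop_lift (a : loop OS base) : RR -> G := s2val (cid2 (loop_lift_exists a)).

Lemma loop_liftP a : lift (loopR a) (loop_lift a).
Proof. by rewrite /loop_lift; case: cid2. Qed.

Lemma loop_lift0 a : loop_lift a 0 = one.
Proof. by rewrite /loop_lift; case: cid2. Qed.

Lemma loop_lift_uniq a g : lift (loopR a) g -> g 0 = one -> forall t, loop_lift a t = g t.
Proof.
move=> hg g0; have [ha _ _] := rloop_loopR a.
apply: (lift_uniq hG wc (loopR a) (loop_lift a) g 0 ha) => //; first exact: loop_liftP.
by rewrite loop_lift0.
Qed.

Lemma loop_lift_phtpy a b : phtpy (OY := OS) (loopR a) (loopR b) -> loop_lift a 1 = loop_lift b 1.
Proof.
case=> H [hH H0 H1 Hl Hr]; have hR := open_is_topology RR.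
have [_ a0 a1] := rloop_loopR a.
have hF z : lp (fun r => H (r, z)).
  split; rewrite ?Hl ?Hr //.
  by apply: rcont_comp hH _; apply: rcont_rr_pair => //; rcont_real.
pose F z := mkloop (hF z).
have FE z r : loopR (F z) r = H (clampR r, z) by [].
have -> : a = F 0 by apply: loop_ext => t /=; rewrite H0 /loopR clampK.
have -> : b = F 1 by apply: loop_ext => t /=; rewrite H1 /loopR clampK.
apply: (locally_constant (fun z => loop_lift (F z) 1)) => z0.
have hpath z : path (loopR (F z)) by case: (rloop_loopR (F z)).
have [_ z00 z01] := rloop_loopR (F z0).
(* For the discrete topology, continuity tested on a singleton is local constancy. *)
have /(_ [set loop_lift (F z0) 1] Logic.I erefl) [V [OV Vz0 hV]] :
    cont_at (OZ := open) [set: set G] (fun z => loop_lift (F z) 1) z0.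
  apply: (lift_cont_at open_UA open_UB susp_cover hG wc hR discrete_group_topology
    (fun z => loopR (F z)) (fun z => loop_lift (F z)) z0 hpath).
  - by move=> z; exact: loop_liftP.
  - by move=> z; exact: loop_lift0.
  - by rewrite z00; exact: base_notin_UA.
  - by rewrite z01; exact: base_notin_UA.
  - move=> U s s' OU hU.
    have hW : prod_top (@open RR) (@open RR) ((fun z : RR * RR => H (clampR z.2, z.1)) @^-1` U).
      have h : rcont rr_top OS (fun z : RR * RR => H (clampR z.2, z.1)).
        by apply: rcont_comp hH _; apply: rcont_rr_pair; rcont_real.
      exact: h.
    exists [set z | forall r : RR, r \in `[s, s'] -> U (loopR (F z) r)]; split=> /=.
    + exact: (tube [set` `[s, s']] _ hR hR (rcompact_segment s s') hW).
    + by move=> r; rewrite in_itv /= => /hU.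
    + by move=> z hz r hr; apply: hz; rewrite in_itv.
  (* With [s] fixed, the homotopy is a path in [z] that stays in the overlap near [z0], so [w] is
     constant on it. *)
  - move=> s As Bs.
    pose f z := H (clampR s, z).
    have hf : path f by apply: rcont_comp hH _; apply: rcont_rr_pair => //; rcont_real.
    have hAB : OS (UA `&` UB).
      exact: (top_setI _ _ susp_top_is_topology open_UA open_UB).
    have [e e0 he] := path_nbhs f _ z0 hf hAB (conj As Bs).
    move=> V _ Vz0; exists [set z | z0 - e < z < z0 + e]; split=> /=.
    + exact: open_itv_oo.
    + by lra.
    + move=> z hz; have ez : w (f z0) = w (f z).
        by apply: (w_const_itv wc f (z0 - e) (z0 + e)) => //; lra.
      by suff : V (w (f z)) by []; rewrite -ez.
have /openRP := OV => /(_ z0 Vz0)[e e0 he].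
by exists e => // z /he /hV.
Qed.

Definition mono (A : pi1S) : G := loop_lift (qrep A) 1.

Lemma mono_cls a : mono (pi1_cls a) = loop_lift a 1.
Proof. by apply: loop_lift_phtpy; apply/pi1_cls_eq; rewrite /pi1_cls qrepK. Qed.

Lemma monoM A B : mono (pi1_mul OS base A B) = mul (mono A) (mono B).
Proof.
have [a ->] : exists a, A = pi1_cls a by exists (qrep A); rewrite /pi1_cls qrepK.
have [b ->] : exists b, B = pi1_cls b by exists (qrep B); rewrite /pi1_cls qrepK.
have ha := rloop_loopR a; have hb := rloop_loopR b.
have hc := rloop_concat _ _ ha hb.
rewrite -(pcls_loopR a) -(pcls_loopR b) pi1_mulE // (pclsE _ hc) !pcls_loopR !mono_cls.
case: (ha) (hb) => pa a0 a1 [pb b0 b1].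
pose g t := if t <= 1/2 then loop_lift a (2 * t) else mul (loop_lift a 1) (loop_lift b (2 * t - 1)).
rewrite (loop_lift_uniq _ g) /g.
- by rewrite ifF; [congr (mul _ (loop_lift b _)); lra|apply/negbTE; lra].
- have -> : loopR (mkloop hc) = concat (loopR a) (loopR b).
    apply/funext => t; rewrite loopR_mkloop.
    have [h|h] := leP t 0.
      rewrite clampR_le0 // concat0 a0 /concat ifT; last by lra.
      by rewrite loopR_le0 //; lra.
    have [h'|h'] := leP t 1; first by rewrite clampR_id //; lra.
    rewrite clampR_ge1 ?concat1 ?b1; last by lra.
    rewrite /concat ifF; last by apply/negbTE; lra.
    by rewrite loopR_ge1 //; lra.
  apply: (lift_concat open_UB hG wc (loopR a) (loopR b) (loop_lift a) (loop_lift b)) => //; try exact: loop_liftP.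
  + by rewrite a1 b0.
  + by rewrite a1; exact: UB_base.
  + exact: loop_lift0.
- by rewrite ifT ?mulr0 ?loop_lift0 //; lra.
Qed.

Lemma mono_wr x : mono (cls (wr x)) = gen x.
Proof.
rewrite pclsE; first exact: rloop_wr.
move=> h; rewrite mono_cls.
(* The explicit lift of a ray: inside [UA] it is [trans] with coordinate [one]. Around times at most
   0 or at least 1, the radius 1/3 keeps the ray in [UB] and the time on one side of 1/2. *)
rewrite (loop_lift_uniq _ (fun t => if t <= 1/2 then one else gen x)).
- by rewrite ifF //; apply/negbTE; lra.
- have -> : loopR (mkloop h) = wr x by apply/funext => r; rewrite loopR_mkloop wr_clampR.
  move=> t; have [t0|t0] := leP t 0.
    exists (1/3); first lra.
    right; exists one => s hs; rewrite ifT; last lra.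
    split=> //; have [s0|s0] := leP s 0; first by rewrite wr_le0 //; exact: UB_base.
    by apply/UB_wr; [lra|left; lra].
  have [t1|t1] := leP 1 t.
    exists (1/3); first lra.
    right; exists (gen x) => s hs; rewrite ifF; last by apply/negbTE; lra.
    split=> //; have [s0|s0] := leP 1 s; first by rewrite wr_ge1 //; exact: UB_base.
    by apply/UB_wr; [lra|right; lra].
  have [||d d0 [d1 d2]] := small_pos t (1 - t); [lra|lra|].
  exists d => //; left; exists one => s hs; rewrite (grp_mul1l _ _ _ hG).
  split; first by apply: UA_wr; lra.
  by case: leP => h'; [rewrite trans_down|rewrite trans_up //; lra].
- by rewrite ifT //; lra.
Qed.
End monodromy.

(** * Initial pieces of a loop, closed up *)

Section tails.

(* Follows the ray through [p] down to the base point [t = 0] of the suspension. *)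
Definition down (p : S) (tau : RR) : S :=
  match pselect (exists xr : X * RR, 0 < xr.2 < 1 /\ p = wr xr.1 xr.2) with
  | left h => wr (proj1_sig (cid h)).1 ((1 - tau) * (proj1_sig (cid h)).2)
  | right _ => base
  end.

Lemma down_wr x r tau : 0 < r < 1 -> down (wr x r) tau = wr x ((1 - tau) * r).
Proof.
move=> hr; rewrite /down; case: pselect => [h|[]]; last by exists (x, r).
by case: cid => -[y s] /= [hs e]; have [-> ->] := wr_inj _ _ _ _ hr hs e.
Qed.

Lemma down_base tau : down base tau = base.
Proof.
rewrite /down; case: pselect => // h; case: cid => -[y s] /= [hs e].
by case: (@base_notin_UA X); rewrite e; exact: UA_wr.
Qed.

Lemma path_down p : path (down p).
Proof.
have hR := open_is_topology RR.
have [->|[x [r [hr ->]]]] := susp_cases p.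
  rewrite (_ : down base = fun=> base); first exact: rcont_cst.
  by apply/funext => tau; exact: down_base.
rewrite (_ : down _ = fun tau => wr x ((1 - tau) * r)).
  by apply: rcont_comp (path_wr x) _; rcont_real.
by apply/funext => tau; exact: down_wr.
Qed.

Lemma down0 p : down p 0 = p.
Proof.
have [->|[x [r [hr ->]]]] := susp_cases p; first exact: down_base.
by rewrite down_wr //; congr wr; lra.
Qed.

Lemma down1 p : down p 1 = base.
Proof.
have [->|[x [r [hr ->]]]] := susp_cases p; first exact: down_base.
by rewrite down_wr // wr_le0 //; lra.
Qed.

Context (f : RR -> S).
Hypothesis hf : lp f.

Definition tail (s : RR) (d : RR -> S) : RR -> S := concat (fun r => f (s * r)) d.

Let path_init s : path (fun r => f (s * r)).
Proof. by case: hf => h _ _; apply: rcont_comp h _; rcont_real. Qed.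

Lemma rloop_tail s d : path d -> d 0 = f s -> d 1 = base -> lp (tail s d).
Proof.
move=> hd d0 d1; split; rewrite /tail ?concat0 ?concat1 //.
  by apply: path_concat => //; rewrite mulr1.
by rewrite mulr0; case: hf.
Qed.

(** The cutting time slides from [s] to [s'] with the homotopy, and [D] supplies a return path for
    each intermediate cut. *)
Lemma tail_phtpy s s' d d' (D : RR * RR -> S) : rcont rr_top OS D ->
  (forall tau, D (0, tau) = f (seg s s' tau)) -> (forall tau, D (1, tau) = base) ->
  (forall t, D (t, 0) = d t) -> (forall t, D (t, 1) = d' t) ->
  cls (tail s d) = cls (tail s' d').
Proof.
move=> hD Dl Dr D0 D1; have hR := open_is_topology RR.
have hd : path d.
  rewrite (_ : d = fun t => D (t, 0)); last by apply/funext.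
  by apply: rcont_comp hD _; apply: rcont_rr_pair => //; rcont_real.
have hd' : path d'.
  rewrite (_ : d' = fun t => D (t, 1)); last by apply/funext.
  by apply: rcont_comp hD _; apply: rcont_rr_pair => //; rcont_real.
case: hf => pf f0 f1; apply: pcls_phtpy.
- by apply: rloop_tail; rewrite // -D0 ?Dr // Dl seg0.
- by apply: rloop_tail; rewrite // -D1 ?Dr // Dl seg1.
exists (fun z => if z.1 <= 1/2 then f (seg s s' z.2 * (2 * z.1)) else D (2 * z.1 - 1, z.2)).
split=> [|t|t|t|t].
- apply: (rcont_paste rr_top_is_topology fst (1/2)
    (fun z => f (seg s s' z.2 * (2 * z.1))) (fun z => D (2 * z.1 - 1, z.2))).
  + exact: rr_fst.
  + apply: rcont_comp pf _.
    have hs : rcont rr_top (@open RR) (fun z => seg s s' z.2) by apply: rcont_comp (rcont_seg s s') rr_snd.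
    by rcont_real.
  + by apply: rcont_comp hD _; apply: rcont_rr_pair; rcont_real.
  + move=> [a b] /= ->; rewrite (_ : 2 * (1/2) = 1); last lra.
    by rewrite subrr Dl mulr1.
- by rewrite /tail /concat /= seg0 D0.
- by rewrite /tail /concat /= seg1 D1.
- by rewrite /tail concat0 /= ifT ?mulr0 //; lra.
- rewrite /tail concat1 /= ifF; last by apply/negbTE; lra.
  by rewrite (_ : 2 * 1 - 1 = 1) ?Dr -?D0 ?Dr //; lra.
Qed.

(** On [UA] the path [down] varies continuously with its starting point, through the coordinates.
    This fails in general at the base point: from heights close to 1 it runs down nearly a whole
    ray. *)
Lemma tail_down_UA a b s s' : (forall r, a < r < b -> UA (f r)) -> a < s < b -> a < s' < b ->
  cls (tail s (down (f s))) = cls (tail s' (down (f s'))).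
Proof.
move=> hA hs hs'; have hR := open_is_topology RR; case: hf => pf _ _.
have [|x [r [hx hr hxr]]] := susp_coords (fun tau => f (seg s s' tau)) hR (rcont_comp f _ pf (rcont_seg s s')).
  by move=> tau; apply: hA; exact: seg_oo.
have es : f s = wr (x 0) (r 0) by have [_] := hxr 0; rewrite seg0.
have es' : f s' = wr (x 1) (r 1) by have [_] := hxr 1; rewrite seg1.
apply: (tail_phtpy s s' _ _ (fun z => wr (x z.2) ((1 - z.1) * r z.2))) => [|tau|tau|t|t] /=.
- have hx2 : rcont rr_top (@open X) (fun z => x z.2) by apply: rcont_comp hx rr_snd.
  have hr2 : rcont rr_top (@open RR) (fun z => r z.2) by apply: rcont_comp hr rr_snd.
  by apply: rcont_wr; rcont_real.
- by have [_ ->] := hxr tau; congr wr; lra.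
- by rewrite wr_le0 // subrr mul0r.
- by rewrite es down_wr //; case: (hxr 0).
- by rewrite es' down_wr //; case: (hxr 1).
Qed.

(** The return path suited to [UB]: [collapse] is continuous everywhere, and on [UB] it ends at the
    base point. *)
Lemma tail_collapse_UB a b s s' : (forall r, a < r < b -> UB (f r)) -> a < s < b -> a < s' < b ->
  cls (tail s (fun tau => collapse (f s, tau))) = cls (tail s' (fun tau => collapse (f s', tau))).
Proof.
move=> hB hs hs'; have hR := open_is_topology RR; case: hf => pf _ _.
apply: (tail_phtpy s s' _ _ (fun z => collapse (f (seg s s' z.2), z.1))) => [|tau|tau|t|t] /=.
- apply: rcont_comp (rcont_collapse) _; apply: rcont_pair => //.
  + exact: rr_top_is_topology.
  + apply: rcont_comp pf _.
    exact: (rcont_comp (seg s s') snd (rcont_seg s s') rr_snd).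
  + exact: rr_fst.
- exact: collapse0.
- by apply: collapse1; apply: hB; exact: seg_oo.
- by rewrite seg0.
- by rewrite seg1.
Qed.

Local Notation wpi := (trans (one := pi1_one OS base) (gen := fun x => cls (wr x))).

Lemma path_collapse p : path (fun tau => collapse (p, tau)).
Proof.
have hR := open_is_topology RR.
apply: rcont_comp (rcont_collapse) _; apply: rcont_pair => //.
exact: rcont_cst.
Qed.

(** Below 1/3 the two return paths coincide. Above 2/3 one goes down the ray and the other up, and
    they differ by the full loop [wr x], the factor supplied by [trans]. *)
Lemma tail_down_collapse s : UB (f s) ->
  pi1_mul OS base (cls (tail s (down (f s)))) (wpi (f s)) =
  cls (tail s (fun tau => collapse (f s, tau))).
Proof.
move=> hB; have hR := open_is_topology RR.
have hlc : lp (tail s (fun tau => collapse (f s, tau))).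
  by apply: rloop_tail; [exact: path_collapse|exact: collapse0|exact: collapse1].
have hld : lp (tail s (down (f s))).
  by apply: rloop_tail; [exact: path_down|exact: down0|exact: down1].
have [e|[x [r [hr e]]]] := susp_cases (f s).
  rewrite {2}e trans_base (grp_mul1r pi1_is_group); congr (cls (tail s _)).
  by apply/funext => tau; rewrite e down_base collapse_base.
move: hB; rewrite e UB_wr // => -[r3|r3].
  rewrite trans_down ?(grp_mul1r pi1_is_group); last lra.
  congr (cls (tail s _)); apply/funext => tau; rewrite down_wr // collapse_wr; last lra.
  by rewrite /psi clampR_le0; [congr wr|]; lra.
rewrite trans_up; last lra.
rewrite -e pi1_mulE //; last exact: rloop_wr.
apply: pcls_phtpy => //; first by apply: rloop_concat => //; exact: rloop_wr.
apply: phtpy_trans (concatA _ _ _ (path_init s) (path_down (f s)) (path_wr x) _ _) _.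
- by rewrite mulr1 down0.
- by rewrite down1 wr_le0.
apply: phtpy_concat; last by rewrite concat0 down0 mulr1.
  exact: phtpy_refl.
(* Along the ray of [x], [phi] goes from [r] down to 0 and then up to 1; it has the same ends as the
   straight way up from [r] to 1. *)
rewrite e; pose phi (t : RR) := if t <= 1/2 then (1 - 2 * t) * r else 2 * t - 1.
have -> : concat (down (wr x r)) (wr x) = fun t => wr x (phi t).
  by apply/funext => t; rewrite /concat /phi down_wr //; case: ifP.
have -> : (fun tau => collapse (wr x r, tau)) = fun tau => wr x ((1 - tau) * r + tau).
  apply/funext => tau; rewrite collapse_wr; last lra.
  by rewrite /psi clampR_ge1 ?mulr1 //; lra.
apply: (phtpy_reparam (wr x) phi (fun tau => (1 - tau) * r + tau)); first exact: path_wr.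
- apply: (rcont_paste hR id (1/2) (fun t => (1 - 2 * t) * r) (fun t => 2 * t - 1)); rcont_real.
  by move=> t ->; lra.
- by rcont_real.
- by rewrite /phi ifT; lra.
- by rewrite /phi ifF; [lra|apply/negbTE; lra].
Qed.

(** The class closed up by [down] is the coordinate over [UA]; over [UB] the product is the class
    closed up by [collapse]. Each is locally constant in its chart. *)
Definition tail_lift (s : RR) : pi1S := pi1_mul OS base (cls (tail s (down (f s)))) (wpi (f s)).

Lemma tail_liftP : is_lift (UA := UA) (UB := UB) (mul := pi1_mul OS base) (w := wpi) f tail_lift.
Proof.
move=> t; have [pf _ _] := hf; have [h|h] := susp_cover (f t).
  have [e e0 he] := path_nbhs f _ t pf open_UA h.
  exists e => //; left; exists (cls (tail t (down (f t)))) => s hs; split; first exact: he.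
  by rewrite /tail_lift (tail_down_UA (t - e) (t + e) s t) //; lra.
have [e e0 he] := path_nbhs f _ t pf open_UB h.
exists e => //; right; exists (tail_lift t) => s hs; split; first exact: he.
rewrite /tail_lift !tail_down_collapse //; last exact: he.
by apply: (tail_collapse_UB (t - e) (t + e)) => //; lra.
Qed.

Lemma tail_lift0 : tail_lift 0 = pi1_one OS base.
Proof.
have [_ f0 _] := hf.
rewrite /tail_lift f0 trans_base (grp_mul1r pi1_is_group) -pcls_cst; congr cls.
by apply/funext => t; rewrite /tail /concat mul0r f0 down_base; case: ifP.
Qed.

Lemma tail_lift1 : tail_lift 1 = cls f.
Proof.
have [pf f0 f1] := hf; have hc : lp (fun=> base) by exact: rloop_cst.
rewrite /tail_lift f1 trans_base (grp_mul1r pi1_is_group) -[RHS](grp_mul1r pi1_is_group).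
rewrite -pcls_cst pi1_mulE //; congr cls; rewrite /tail; congr concat.
  by apply/funext => t; rewrite mul1r.
by apply/funext => t; rewrite down_base.
Qed.
End tails.

Section inverse.
Context {G : Type} {mul : G -> G -> G} {inv : G -> G} {one : G}.
Hypothesis hG : is_group mul inv one.
Context {gen : X -> G}.
Hypothesis gen_path : forall x y, path_conn open x y -> gen x = gen y.

(* Both sides are the value at [1] of a lift of the loop with values in the fundamental group. *)
Lemma mono_section (h : G -> pi1S) :
  (forall a b, h (mul a b) = pi1_mul OS base (h a) (h b)) ->
  (forall x, h (gen x) = cls (wr x)) ->
  forall A, h (mono hG gen_path A) = A.
Proof.
move=> hM hgen A; rewrite -[RHS]qrepK; set a := qrep A.
rewrite -/(pi1_cls a) -pcls_loopR -tail_lift1; last exact: rloop_loopR.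
have h1 : h one = pi1_one OS base by exact: (grp_hom1 hG pi1_is_group h hM).
have [pa _ _] := rloop_loopR a.
apply: (lift_uniq pi1_is_group (trans_const (one := pi1_one OS base) (gen := fun x => cls (wr x)) pcls_wr_path_conn)
  (loopR a) (fun t => h (loop_lift hG gen_path a t)) (tail_lift (loopR a)) 0 pa).
(* [h] carries the transition function of [G] to that of the fundamental group, hence lifts to
   lifts. *)
- move=> t; have [e e0 he] := loop_liftP hG gen_path a t; exists e => //.
  case: he => -[k hk]; [left|right]; exists (h k) => s /hk[hs ->]; split=> //.
  rewrite hM; congr (pi1_mul _ _ _ _).
  by rewrite /trans; case: pselect => // hx; exact: hgen.
- by apply: tail_liftP; exact: rloop_loopR.
- by rewrite loop_lift0 tail_lift0 //; exact: rloop_loopR.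
Qed.
End inverse.
End susp_homotopy.

(** * The isomorphism *)

Lemma path_connP {T : Type} {O : set (set T)} (x y : T) :
  path_conn O x y <-> exists p : RR -> T, [/\ rcont open O p, p 0 = x & p 1 = y].
Proof.
split=> [[p [hp <- <-]]|[p [hp <- <-]]].
  exists (fun r => p (clamp r)); split.
  - by apply: rcont_comp hp _; rcont_real.
  - by rewrite clamp_le0.
  - by rewrite clamp_ge1.
by exists (fun t => p (proj1_sig t)); split=> //; apply: rcont_comp hp rcont_val.
Qed.

Lemma path_conn_refl {T : Type} {O : set (set T)} (x : T) : path_conn O x x.
Proof.
by apply/path_connP; exists (fun=> x); split=> //; apply: rcont_cst; exact: open_is_topology.
Qed.

Lemma pi0_cls_eq {T : Type} {O : set (set T)} (x y : T) :
  pi0_cls O x = pi0_cls O y <-> path_conn O x y.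
Proof.
have hR := open_is_topology RR.
split; first by apply: qcls_inj; exact: path_conn_refl.
apply: qcls_eq => [{}x {}y|{}x {}y z] /path_connP[p [hp <- <-]].
  apply/path_connP; exists (fun r => p (1 - r)); rewrite subr0 subrr; split=> //.
  by apply: rcont_comp hp _; rcont_real.
move=> /path_connP[q [hq q0 <-]]; apply/path_connP; exists (concat p q).
by rewrite concat0 concat1; split=> //; apply: path_concat.
Qed.

Lemma path_conn_continuous {S T : topologicalType} (f : S -> T) x y : continuous f ->
  path_conn open x y -> path_conn open (f x) (f y).
Proof.
move=> /rcont_continuous cf [p [hp <- <-]]; exists (fun t => f (p t)); split=> //.
exact: rcont_comp cf hp.
Qed.

Lemma pi0_mapE {S T : topologicalType} (f : S -> T) x : continuous f ->
  pi0_map open open f (pi0_cls open x) = pi0_cls open (f x).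
Proof.
move=> cf; apply/pi0_cls_eq; apply: path_conn_continuous => //.
by apply/pi0_cls_eq; rewrite /pi0_cls qrepK.
Qed.

Section susp_map.
Context {X Y : topologicalType} (f : X -> Y).

Lemma susp_mapE o t : susp_map f (susp_q (o, t)) = susp_q (omap f o, t).
Proof.
rewrite /susp_map.
have /susp_q_eq[->//|[h1 h2]] : susp_q (qrep (susp_q (o, t))) = susp_q (o, t) by exact: qrepK.
have aux (q : option X * I) : susp_base q -> susp_base (omap f q.1, q.2).
  by case=> [/= ->|h]; [left|right].
by rewrite (susp_q_base _ (aux _ h1)) (susp_q_base _ (aux (o, t) h2)).
Qed.

Lemma susp_map_pt : susp_map f susp_pt = susp_pt.
Proof. exact: susp_mapE. Qed.

Lemma rcont_susp_map : continuous f -> rcont (susp_top X) (susp_top Y) (susp_map f).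
Proof.
move=> /rcont_continuous cf V OV.
have hI := I_top_is_topology; have hX := @plus_top_is_topology X; have hY := @plus_top_is_topology Y.
have hP : is_topology (prod_top (plus_top X) I_top) by exact: prod_top_is_topology.
have hm : rcont (prod_top (plus_top X) I_top) (prod_top (plus_top Y) I_top)
    (fun p => (omap f p.1, p.2)).
  apply: rcont_pair => //; last exact: rcont_snd.
  have h1 : rcont (plus_top X) (plus_top Y) (omap f) by move=> U /cf.
  exact: rcont_comp h1 (rcont_fst hI).
suff e : susp_q @^-1` (susp_map f @^-1` V) =
    (fun p : option X * I => (omap f p.1, p.2)) @^-1` (susp_q @^-1` V).
  by rewrite /susp_top /quot_top /= e; exact: hm.
by apply/seteqP; split=> -[o t] /=; rewrite susp_mapE.
Qed.
End susp_map.

Section isomorphism.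
Context {X : topologicalType}.
Local Notation OS := (susp_top X).
Local Notation base := (@susp_pt X).
Local Notation cls := (pcls (OY := OS) (y0 := base)).
Local Notation FMX := (FMpi0_top X).

Definition pi0_gen (x : X) : FMpi0 X := FG_gen (pi0_cls open x).

Lemma pi0_gen_path x y : path_conn open x y -> pi0_gen x = pi0_gen y.
Proof. by move=> /pi0_cls_eq e; rewrite /pi0_gen e. Qed.

Lemma pi0_surj (c : pi0 (@open X)) : exists x, c = pi0_cls open x.
Proof. by exists (qrep c); rewrite /pi0_cls qrepK. Qed.

Lemma pi0_top_is_topology : is_topology (pi0_top (@open X)).
Proof. by apply: quot_top_is_topology; exact: open_is_topology. Qed.

Lemma rcont_pi0_gen : rcont (@open X) FMX pi0_gen.
Proof. by move=> V /(FM_gen pi0_top_is_topology). Qed.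

Definition susp_iso : FMpi0 X -> piS X :=
  FG_ext (mul := piS_mul X) (inv := pi1_inv OS base) (one := pi1_one OS base)
    (fun c => cls (wr (qrep c))).

Lemma susp_isoM A B : susp_iso (FG_mul A B) = piS_mul X (susp_iso A) (susp_iso B).
Proof. exact: FG_extM pi1_is_group _ A B. Qed.

Lemma susp_iso_gen x : susp_iso (pi0_gen x) = cls (wr x).
Proof.
rewrite /susp_iso (FG_ext_gen pi1_is_group); apply: pcls_wr_path_conn.
by apply/pi0_cls_eq; rewrite /pi0_cls qrepK.
Qed.

Definition susp_iso_inv : piS X -> FMpi0 X := mono FG_is_group pi0_gen_path.

Lemma susp_iso_invK A : susp_iso (susp_iso_inv A) = A.
Proof. by apply: (mono_section FG_is_group pi0_gen_path); [exact: susp_isoM|exact: susp_iso_gen]. Qed.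

Lemma susp_iso_invM A B : susp_iso_inv (piS_mul X A B) = FG_mul (susp_iso_inv A) (susp_iso_inv B).
Proof. exact: monoM. Qed.

Lemma susp_isoK A : susp_iso_inv (susp_iso A) = A.
Proof.
apply: (FG_hom_uniq FG_is_group (fun A => susp_iso_inv (susp_iso A)) id) => // [B C|c].
  by rewrite susp_isoM susp_iso_invM.
by have [x ->] := pi0_surj c; rewrite -/(pi0_gen x) susp_iso_gen; exact: mono_wr.
Qed.

Lemma loop_top_is_topology : is_topology (loop_top OS base).
Proof. by apply: sub_top_is_topology; exact: gen_top_is_topology. Qed.

Lemma pi1_qtop_is_topology : is_topology (pi1_qtop OS base).
Proof. by apply: quot_top_is_topology; exact: loop_top_is_topology. Qed.

Definition ray (x : X) : loop OS base := mkloop (rloop_wr x).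

(** The adjoint of a continuous map on the product of [X] and the interval; on subbasic sets of the
    compact-open topology this is the tube lemma. *)
Lemma rcont_ray : rcont (@open X) (loop_top OS base) ray.
Proof.
have hO := open_is_topology X; have hI := I_top_is_topology.
have hP : is_topology (prod_top (@open X) I_top) by exact: prod_top_is_topology.
move=> _ [W [OW ->]]; move: W OW.
suff : rcont (@open X) (Defs.compact_open OS) (fun x t => wr x (proj1_sig t)) by [].
apply: rcont_gen => // _ [K [U [cK OU ->]]].
have hw : rcont (prod_top (@open X) I_top) OS (fun z => wr z.1 (proj1_sig z.2)).
  apply: rcont_wr => //; first exact: rcont_fst.
  exact: rcont_comp rcont_val (rcont_snd hO).
have := tube K _ hO hI cK (hw _ OU); congr open; apply/seteqP; split=> x /= h.
  by move=> _ [t Kt <-]; apply: h.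
by move=> t Kt; apply: h; exists t.
Qed.

(** [loopR] factors through [clamp], which sends the segment to a compact set even if the bounds
    leave the unit interval; so the set is subbasic. *)
Lemma loop_top_segment U (s s' : RR) : OS U ->
  loop_top OS base [set a | forall r : RR, s <= r <= s' -> U (loopR a r)].
Proof.
move=> OU; pose K : set RR := [set` `[s, s']].
exists [set f | f @` (clamp @` K) `<=` U]; split.
  apply: gen_top_sub; exists (clamp @` K), U; split=> //.
  have hc : rcont (@open RR) I_top clamp.
    by apply: (rcont_clamp id); [exact: open_is_topology|exact: rcont_id].
  exact: rcompact_image hc (rcompact_segment s s').
apply/seteqP; split=> a /= h.
  by move=> _ [_ [r Kr <-] <-]; apply: h; move: Kr; rewrite /K /= in_itv.
by move=> r hr; apply: h; exists (clamp r) => //; exists r; rewrite // /K /= in_itv.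
Qed.

Lemma rcont_loop_lift :
  rcont (loop_top OS base) FMX (fun a => loop_lift FG_is_group pi0_gen_path a 1).
Proof.
have hL := loop_top_is_topology.
apply: (cont_at_rcont hL) => a0; have [_ a00 a01] := rloop_loopR a0.
apply: (lift_cont_at open_UA open_UB susp_cover FG_is_group (trans_const pi0_gen_path) hL
  FM_group_topology loopR (loop_lift FG_is_group pi0_gen_path) a0).
- by move=> a; case: (rloop_loopR a).
- exact: loop_liftP.
- exact: loop_lift0.
- by rewrite a00; exact: base_notin_UA.
- by rewrite a01; exact: base_notin_UA.
- move=> U s s' OU hU.
  by exists [set a | forall r : RR, s <= r <= s' -> U (loopR a r)]; split=> //; exact: loop_top_segment.
move=> s [x [r [_ /= hr e]]]; rewrite e UB_wr // => r3.
have eval (U : set (susp X)) : OS U -> U (loopR a0 s) ->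
    exists W, [/\ loop_top OS base W, W a0 & forall a, W a -> U (loopR a s)].
  move=> OU Us; exists [set a | forall r : RR, s <= r <= s -> U (loopR a r)]; split.
  - exact: loop_top_segment.
  - by move=> r' hr' /=; rewrite (_ : r' = s) //; lra.
  - by move=> a; apply; lra.
move=> V OV; rewrite e; case: r3 => r3.
  rewrite trans_down => [V1|]; last lra.
  (* Loops close to [a0] are still below 1/3 at time [s], where [trans] is [one]. *)
  have [||W [OW Wa0 hW]] := eval (cyl setT [set r : RR | 0 < r < 1/3]).
  - apply: open_cyl; [exact: openT|exact: open_itv_oo|move=> r' /=; lra].
  - by rewrite e; exists x, r; split=> //=; lra.
  exists W; split=> // a /hW[y [r' [_ /= hr' ->]]].
  by rewrite trans_down //; lra.
rewrite trans_up => [Vx|]; last lra.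
(* Close loops may pass over points [y] of other path components; the cylinder keeps those whose
   generator is in [V], and it is open because generators depend continuously on points of [X]. *)
have [||W [OW Wa0 hW]] := eval (cyl (pi0_gen @^-1` V) [set r : RR | 2/3 < r < 1]).
- apply: open_cyl; [exact: rcont_pi0_gen|exact: open_itv_oo|move=> r' /=; lra].
- by rewrite e; exists x, r; split=> //=; lra.
exists W; split=> // a /hW[y [r' [Vy /= hr' ->]]].
by rewrite trans_up //; lra.
Qed.

(** Only generators matter. As [tau] is coarser than the quotient topology, an open set pulls back
    to an open set of loops, and then along [ray] to an open set of [X]. *)
Lemma rcont_susp_iso : rcont FMX (piS_tau X) susp_iso.
Proof.
have tG : group_topology (piS_mul X) (pi1_inv OS base) (piS_tau X) := tau_group_topology pi1_is_group.
apply: (FM_univ pi1_is_group _ susp_iso susp_isoM tG) => V OV.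
have OV' := tau_sub pi1_is_group pi1_qtop_is_topology V OV.
suff e : pi0_cls open @^-1` ((fun c => susp_iso (FG_gen c)) @^-1` V) =
    ray @^-1` ((@pi1_cls _ OS base) @^-1` V).
  by rewrite /pi0_top /quot_top /= e; exact: rcont_ray.
by apply/seteqP; split=> x /=; rewrite -/(pi0_gen x) susp_iso_gen (pclsE _ (rloop_wr x)).
Qed.

(** Openness is continuity of the inverse. On [tau] it is tested after composing with [m], a
    homomorphism from a free topological group, hence on its generators, the classes of loops, and
    so on the loop space. *)
Lemma open_susp_iso U : FMX U -> piS_tau X (susp_iso @` U).
Proof.
move=> OU; rewrite /piS_tau /tau_top /quot_top /=.
set m := mult_epi _ _ _.
have -> : m @^-1` (susp_iso @` U) = (fun A => susp_iso_inv (m A)) @^-1` U.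
  apply/seteqP; split=> A /=; first by move=> [B UB <-]; rewrite susp_isoK.
  by move=> h; exists (susp_iso_inv (m A)) => //; exact: susp_iso_invK.
suff h : rcont (FM_top (pi1_qtop OS base)) FMX (fun A => susp_iso_inv (m A)) by exact: h.
apply: (FM_univ FG_is_group); [|exact: FM_group_topology|].
  by move=> A B; rewrite /m (mult_epiM pi1_is_group) susp_iso_invM.
move=> V OV; rewrite (_ : _ @^-1` V = susp_iso_inv @^-1` V); last first.
  by apply/seteqP; split=> A /=; rewrite /m (mult_epi_gen pi1_is_group).
have := rcont_loop_lift V OV; rewrite /pi1_qtop /quot_top /=; congr (loop_top _ _ _).
by apply/seteqP; split=> a /=; rewrite /susp_iso_inv mono_cls.
Qed.

Lemma susp_iso_topgroup_iso : topgroup_iso FG_mul FMX (piS_mul X) (piS_tau X) susp_iso.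
Proof.
split; [by exists susp_iso_inv; [exact: susp_isoK|exact: susp_iso_invK]|exact: susp_isoM|exact: rcont_susp_iso|exact: open_susp_iso].
Qed.
End isomorphism.

Lemma susp_iso_natural (X Y : topologicalType) (f : X -> Y) (A : FMpi0 X) : continuous f ->
  susp_iso (FG_map (pi0_map (@open X) (@open Y) f) A) = piS_map X Y f (susp_iso A).
Proof.
move=> cf; have hf := rcont_susp_map f cf; have f0 := susp_map_pt f.
apply: (FG_hom_uniq pi1_is_group (fun A => susp_iso (FG_map (pi0_map open open f) A))
  (fun A => piS_map X Y f (susp_iso A))) => [B C|B C|c].
- by rewrite FG_mapM; exact: susp_isoM.
- by rewrite susp_isoM; exact: pi1_map_hom.
have [x ->] := pi0_surj c.
rewrite /FG_gen FG_mapE /= pi0_mapE // -!/(FG_gen _) -!/(pi0_gen _) !susp_iso_gen.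
rewrite /piS_map (pi1_mapE _ _ hf f0 (rloop_wr x)); congr pcls.
by apply/funext => r; rewrite /wr /wedge_pt susp_mapE.
Qed.

Theorem theorem4p1 :
  exists h : forall X : topologicalType, FMpi0 X -> piS X,
    [/\ (* h_X is an isomorphism of topological groups F_M(pi_0^qtop X) -> pi_1^tau(Sigma(X_+)) *)
        forall X : topologicalType,
          topgroup_iso FG_mul (FMpi0_top X) (piS_mul X) (piS_tau X) (h X),
        (* h_X sends the generator [x] to the class of the loop u_x(t) = x /\ t *)
        forall (X : topologicalType) (x : X),
          exists u : loop (susp_top X) susp_pt,
            h X (FG_gen (pi0_cls (@open X) x)) = pi1_cls u /\
            forall t : I, proj1_sig u t = wedge_pt x t
      & (* naturality in X *)
        forall (X Y : topologicalType) (f : X -> Y), continuous f ->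
          forall A : FMpi0 X,
            h Y (FG_map (pi0_map (@open X) (@open Y) f) A) = piS_map X Y f (h X A)].
Proof.
exists @susp_iso; split=> [X|X x|X Y f cf A].
- exact: susp_iso_topgroup_iso.
- exists (ray x); split; first by rewrite -/(pi0_gen x) susp_iso_gen (pclsE _ (rloop_wr x)).
  by move=> t; rewrite /= /wr clampK.
- exact: susp_iso_natural.
Qed.
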